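(* Let $m \geq 2$ and $n_1,\ldots,n_m\geq 1$ be integers with at least one $n_i \geq 2$, and let $\mathcal{J}=\{(i,j): 1\leq i\leq m,\ 1\leq j\leq n_i\}$. Let real numbers $a_{ij}, c_{ij}$ ($(i,j)\in\mathcal{J}$) and $b_i,d_i$ ($1\leq i\leq m$) satisfy: (i) $0<a_{ij}<b_i<1$ for each $(i,j)\in\mathcal{J}$, $\sum_{i=1}^m b_i\leq 1$, and $\sum_{j=1}^{n_i}a_{ij}\leq 1$ for each $i$; (ii) $0\leq d_1<d_2<\cdots<d_m<1$, $d_{i+1}\geq d_i+b_i$ for $1\leq i<m$, and $d_m+b_m\leq 1$; (iii) for each $i$, $0\leq c_{i1}<c_{i2}<\cdots<c_{in_i}<1$, $c_{i(j+1)}\geq c_{ij}+a_{ij}$ for $1\leq j<n_i$, and $c_{in_i}+a_{in_i}\leq 1$. Let $S\subset[0,1]^2$ be the self-affine limit set generated by the maps $A_{ij}:\mathbb{R}^2\to\mathbb{R}^2$, $A_{ij}(x,y)=(a_{ij}x+c_{ij},\ b_iy+d_i)$, $(i,j)\in\mathcal{J}$. Let $\beta_y\in(0,1]$ be the solution of $\sum_{i=1}^m b_i^{\beta_y}=1$, and let $$\beta_x=\max\Big\{a : \exists\, i\in\{1,\ldots,m\} \text{ with } \sum_{j=1}^{n_i}a_{ij}^{a}=1\Big\}\in(0,1].$$ If $\beta_x<1$ and $\beta_y<1$, then the conformal Assouad dimension of $S$ is $\mathcal{C}\mathrm{dim}_A(S)=0$. Otherwise, $S$ is minimal for conformal Assouad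 dimension, i.e., $\mathcal{C}\mathrm{dim}_A(S)=\dim_A(S)$.
   Context: The limit set $S$ of the maps $A_{ij}$ is the unique non-empty compact set with $S=\bigcup_{(i,j)\in\mathcal{J}}A_{ij}(S)$; it carries the Euclidean metric. The Assouad dimension $\dim_A(X)$ of a metric space $X$ is the infimum of all $\alpha>0$ for which there exists a constant $C>0$ such that for any $r,R$ with $0 < r \leq \frac12 R \leq \operatorname{diam}(X)$, any ball $B(x,R)\subset X$ may be covered by at most $C (R/r)^\alpha$ balls of radius $r$. A homeomorphism $f:X\to Y$ of metric spaces is quasi-symmetric if there is a homeomorphism $\eta:[0,\infty)\to[0,\infty)$ such that for all $x,a,b\in X$ with $x \neq b$, $\frac{d_Y(f(x),f(a))}{d_Y(f(x),f(b))} \leq \eta\left(\frac{d_X(x,a)}{d_X(x,b)}\right)$. The conformal Assouad dimension $\mathcal{C}\mathrm{dim}_A(X)$ is the infimum of $\dim_A(Y)$ over all metric spaces $Y$ for which there is a quasi-symmetric homeomorphism $X\to Y$. *)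

(* Defs.v *)
From HB Require Import structures.
From mathcomp Require Import all_boot all_order all_algebra.
From mathcomp Require Import ring lra.
From mathcomp Require Import all_classical all_reals all_analysis.

Set Implicit Arguments.
Unset Strict Implicit.
Unset Printing Implicit Defensive.

Import Order.TTheory GRing.Theory Num.Theory.
Import numFieldNormedType.Exports.

Local Open Scope classical_set_scope.
Local Open Scope ring_scope.

(* An alias of R * R, because the library equips R * R itself with the sup
   metric. *)
Definition plane (R : realType) : Type := (R * R)%type.

Section EuclideanPlane.
Context {R : realType}.

Definition euclid_dist (p q : plane R) : R :=
  Num.sqrt ((p.1 - q.1) ^+ 2 + (p.2 - q.2) ^+ 2).

Lemma euclid_distxx p : euclid_dist p p = 0.
Proof. by rewrite /euclid_dist !subrr expr0n /= addr0 sqrtr0. Qed.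

Lemma euclid_dist_eq0 p q : euclid_dist p q = 0 -> p = q.
Proof.
move=> /eqP; rewrite sqrtr_eq0 => h.
have h1 : (p.1 - q.1) ^+ 2 = 0.
  by apply/eqP; rewrite eq_le sqr_ge0 andbT (le_trans _ h)// lerDl sqr_ge0.
have h2 : (p.2 - q.2) ^+ 2 = 0.
  by apply/eqP; rewrite eq_le sqr_ge0 andbT (le_trans _ h)// lerDr sqr_ge0.
move/eqP: h1; rewrite sqrf_eq0 subr_eq0 => /eqP e1.
move/eqP: h2; rewrite sqrf_eq0 subr_eq0 => /eqP e2.
by rewrite (surjective_pairing p) (surjective_pairing q) e1 e2.
Qed.

Lemma euclid_distC p q : euclid_dist p q = euclid_dist q p.
Proof. by congr Num.sqrt; ring. Qed.

Lemma euclid_dist_triangle q p r :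
  euclid_dist p r <= euclid_dist p q + euclid_dist q r.
Proof.
rewrite /euclid_dist.
set u := p.1 - q.1; set v := p.2 - q.2; set s := q.1 - r.1; set t := q.2 - r.2.
have -> : p.1 - r.1 = u + s by rewrite /u /s; ring.
have -> : p.2 - r.2 = v + t by rewrite /v /t; ring.
have uv0 : 0 <= u ^+ 2 + v ^+ 2 by rewrite addr_ge0 ?sqr_ge0.
have st0 : 0 <= s ^+ 2 + t ^+ 2 by rewrite addr_ge0 ?sqr_ge0.
rewrite -[leRHS]ger0_norm ?addr_ge0 ?sqrtr_ge0// -[leRHS]sqrtr_sqr.
rewrite ler_wsqrtr// [leRHS]sqrrD !sqr_sqrtr// -sqrtrM//.
have cs : u * s + v * t <= Num.sqrt ((u ^+ 2 + v ^+ 2) * (s ^+ 2 + t ^+ 2)).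
  apply: le_trans (ler_norm _) _; rewrite -sqrtr_sqr ler_wsqrtr//.
  have := sqr_ge0 (u * t - v * s); nra.
by rewrite mulr2n; lra.
Qed.

HB.instance Definition _ := Choice.copy (plane R) (R * R)%type.
HB.instance Definition _ := @isMetric.Build R (plane R) euclid_dist
  euclid_distxx euclid_dist_eq0 euclid_distC euclid_dist_triangle.

End EuclideanPlane.

(* The library makes the type of points of a subset of X a pseudometric space;
   with the restricted distance it is a metric space. *)
Section SubsetMetric.
Context {R : realType} {X : metricType R} (A : set X).

Definition subset_dist (x y : A) : R := mdist (set_val x) (set_val y).

Lemma subset_dist_ge0 x y : 0 <= subset_dist x y.
Proof. exact: mdist_ge0. Qed.

Lemma subset_dist_eq0 x y : subset_dist x y = 0 -> x = y.
Proof. by move=> /mdist_positivity; rewrite set_valE => /val_inj. Qed.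

Lemma subset_ballE (x : A) (e : R) : ball x e = [set y | subset_dist x y < e].
Proof.
change ((fun y : A => ball (set_val x) e (set_val y)) =
  [set y | subset_dist x y < e]).
by rewrite ballEmdist.
Qed.

HB.instance Definition _ := @PseudoMetric_isMetric.Build R (set_type A)
  subset_dist subset_dist_ge0 subset_dist_eq0 subset_ballE.

End SubsetMetric.

Definition diam {R : realType} (X : metricType R) : \bar R :=
  ereal_sup [set (mdist xy.1 xy.2)%:E | xy in [set: X * X]].

(* Balls of X are the library's open balls, with centers in X. *)
Definition assouad_bound {R : realType} (X : metricType R) (alpha : R) : Prop :=
  exists2 C : R, 0 < C &
    forall r rho : R, 0 < r -> r <= rho / 2 -> ((rho / 2)%:E <= diam X)%E ->
    forall x : X, exists s : seq X,
      (size s)%:R <= C * (rho / r) `^ alpha /\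
      ball x rho `<=` \bigcup_(y in [set` s]) ball y r.

Definition assouad_dim {R : realType} (X : metricType R) : \bar R :=
  ereal_inf [set alpha%:E | alpha in
    [set alpha : R | 0 < alpha /\ assouad_bound X alpha]].

Definition homeomorphism_on {X Y : topologicalType} (A : set X) (B : set Y)
    (f : X -> Y) : Prop :=
  exists g : Y -> X,
    [/\ set_fun A B f, set_fun B A g,
        {in A, cancel f g}, {in B, cancel g f} &
        {within A, continuous f} /\ {within B, continuous g}].

Definition quasisymmetric {R : realType} {X Y : metricType R} (f : X -> Y) :
    Prop :=
  homeomorphism_on setT setT f /\
  exists2 eta : R -> R, @homeomorphism_on R R `[0, +oo[ `[0, +oo[ eta &
    forall x a b : X, x <> b ->
      mdist (f x) (f a) / mdist (f x) (f b) <= eta (mdist x a / mdist x b).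

Definition conformal_assouad_dim {R : realType} (X : metricType R) : \bar R :=
  ereal_inf [set D | exists (Y : metricType R) (f : X -> Y),
    quasisymmetric f /\ D = assouad_dim Y].

Definition carpet_map {R : realType} {m : nat} {n : 'I_m -> nat}
    (a c : forall i, 'I_(n i) -> R) (b d : 'I_m -> R)
    (i : 'I_m) (j : 'I_(n i)) (p : plane R) : plane R :=
  (a i j * p.1 + c i j, b i * p.2 + d i).

Definition is_limit_set {R : realType} {m : nat} {n : 'I_m -> nat}
    (a c : forall i, 'I_(n i) -> R) (b d : 'I_m -> R) (S : set (plane R)) :
    Prop :=
  [/\ compact S, S !=set0 &
      S = \bigcup_(i : 'I_m) \bigcup_(j : 'I_(n i))
            (@carpet_map R m n a c b d i j @` S)].

(* Main.v *)
From HB Require Import structures.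
Require Import Defs.
From mathcomp Require Import all_boot all_order all_algebra.
From mathcomp Require Import ring lra zify.
From mathcomp Require Import all_classical all_reals all_analysis.

Set Implicit Arguments.
Unset Strict Implicit.
Unset Printing Implicit Defensive.

Import Order.TTheory GRing.Theory Num.Theory.
Import numFieldNormedType.Exports.

Local Open Scope classical_set_scope.
Local Open Scope ring_scope.

(** At every scale S is made of approximate squares. Since a row is higher than
    its letters are wide, a word of k letters in the rows w has a cylinder that
    is higher than wide; the points whose rows begin with w, of height about R,
    and whose letters begin with a shorter word u, of width about R, form an
    approximate square. In its interior S resembles a product of two
    self-similar subsets of the line, a vertical one of dimension beta_y and a
    horizontal one of dimension at most beta_x.

    Upper bound. Words are cut as soon as their ratio falls below a given scale
    ([stopping]). By the equations defining the exponents, an approximate square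
    of size R contains at most a constant times (R / r) ^ beta_y rows of height
    r, each with at most a constant times (R / r) ^ beta_x columns of width r.
    So the Assouad dimension of S is at most beta_x + beta_y
    ([carpet_doubling]).

    If both exponents are less than 1, the rows have total height less than 1,
    and the letters of each row have total width less than 1. All the
    one-dimensional sets involved are then uniformly porous ([porous]), even
    boundedly many of them simultaneously ([porous_seq]). A chain of points of S
    with steps e cannot jump over gaps longer than e, so it has diameter at most
    C * e: S is uniformly disconnected ([carpet_uniformly_disconnected]). Its
    metric is then comparable to an ultrametric, the powers of an ultrametric
    are quasi-symmetrically equivalent metrics, and high powers have small
    dimension ([conformal_dim_uniformly_disconnected]).

    Otherwise one of the two directions is filled by intervals without gaps.
    With s > 0 the exponent of the other direction, the upper bound is 1 + s. In
    the approximate squares of S one finds, for every N, about N ^ s discrete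
    paths with N steps each, spread like a product of an interval and a set of
    dimension s ([ladder], [vertical_ladders], [horizontal_ladders]).
    Quasi-symmetric maps preserve the relevant comparisons of distances: the
    image paths remain about as long as the diameter D of the whole image, and
    an image point is isolated in proportion to the length of the step that
    follows. If the image satisfied an Assouad bound of exponent alpha < 1 + s,
    counting points by dyadic step length would bound the total length of all
    the steps by a constant times D * N ^ (alpha - 1), less than the N ^ s * D
    that the paths require when N is large ([ladder_bound]). So 1 + s is a lower
    bound for the dimension of every quasi-symmetric image of S. *)

(** * Words and their cylinders on the line *)

Section Line.
Context {R : realType} {L : eqType} (rho tau : L -> R).
Implicit Types (l : L) (v w : seq L) (A : seq L) (As : seq (seq L)) (beta t : R).

(** A word stands for the composite of the maps t |-> tau l + rho l * t of its
    letters, the first letter outermost; this composite is the map t |->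
    wshift w + wratio w * t and carries [0, 1] onto the cylinder of w. *)
Definition wratio w : R := \prod_(l <- w) rho l.

Definition wshift w : R := foldr (fun l t => tau l + rho l * t) 0 w.

Definition cylinder w : set R := `[wshift w, wshift w + wratio w].

(** Listing the intervals of A from left to right makes arguments on lengths
    and gaps inductions from the left end; intervals may touch. *)
Fixpoint ordered (x : R) A (y : R) : Prop :=
  if A is l :: A' then x <= tau l /\ ordered (tau l + rho l) A' y else x <= y.

(** Each position has its own alphabet, since in the horizontal direction the
    letters available at a position depend on the row chosen there. *)
Definition fits w As : bool := all2 (fun l A => l \in A) w As.

(** The minimal words of ratio at most t, a cut of the tree of words into
    cylinders of comparable lengths. Below the letter l the threshold becomes
    t / rho l; a branch that exhausts its alphabets is cut at its end. *)
Fixpoint stopping As (t : R) : seq (seq L) :=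
  if As is A :: As' then
    if 1 <= t then [:: [::]]
    else flatten [seq [seq l :: v | v <- stopping As' (t / rho l)] | l <- A]
  else [:: [::]].

Lemma wratio_nil : wratio [::] = 1.
Proof. exact: big_nil. Qed.

Lemma wratio_cons l w : wratio (l :: w) = rho l * wratio w.
Proof. exact: big_cons. Qed.

Lemma wratio_cat v w : wratio (v ++ w) = wratio v * wratio w.
Proof. exact: big_cat. Qed.

Lemma wshift_cat v w : wshift (v ++ w) = wshift v + wratio v * wshift w.
Proof.
elim: v => [|l v IH] /=; first by rewrite wratio_nil add0r mul1r.
by rewrite IH wratio_cons; ring.
Qed.

Lemma fits_cat v w As Bs : fits v As -> fits w Bs -> fits (v ++ w) (As ++ Bs).
Proof. by elim: v As => [|l v IH] [|A As]//= /andP[-> /IH]. Qed.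

Lemma fits_size w As : fits w As -> size w = size As.
Proof. by rewrite /fits all2E => /andP[/eqP]. Qed.

Lemma fits_take w As k : fits w As -> fits (take k w) (take k As).
Proof.
by elim: w As k => [|l w IH] [|A As]//= [|k]//= /andP[-> /IH]; apply.
Qed.

Lemma fits_drop w As k : fits w As -> fits (drop k w) (drop k As).
Proof.
by elim: w As k => [|l w IH] [|A As]//= [|k]//= /andP[lA]; exact: IH.
Qed.

Lemma stopping_fits As t v : v \in stopping As t -> fits v (take (size v) As).
Proof.
elim: As t v => [|A As IH] t v /=; first by rewrite inE => /eqP->.
case: ifP => _; first by rewrite inE => /eqP->.
move=> /flatten_mapP[l lA /mapP[v' v'in ->]] /=.
by rewrite lA /=; exact: IH v'in.
Qed.

Lemma stopping_prefix As t w : fits w As ->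
  exists2 v, v \in stopping As t & exists w', w = v ++ w'.
Proof.
elim: As t w => [|A As IH] t [|l w]//=; first by exists [::] => //; exists [::].
case: ifP => _; first by exists [::] => //; exists (l :: w).
move=> /andP[lA /(IH (t / rho l))[v vin [w' ->]]].
exists (l :: v); last by exists w'.
by apply/flatten_mapP; exists l => //; exact: map_f.
Qed.

Context (lo hi : R) (lo_gt0 : 0 < lo).

Definition alphabet A : Prop :=
  ordered 0 A 1 /\ forall l, l \in A -> lo <= rho l <= hi.

Lemma alphabet_gt0 A l : alphabet A -> l \in A -> 0 < rho l.
Proof. by move=> [_ h] /h /andP[h1 _]; exact: lt_le_trans h1. Qed.

Definition alphabets As : Prop := forall A, A \in As -> alphabet A.

Lemma alphabets_cons A As : alphabets (A :: As) -> alphabet A /\ alphabets As.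
Proof.
move=> h; split; first by apply: h; rewrite mem_head.
by move=> B BAs; apply: h; rewrite inE BAs orbT.
Qed.

Lemma alphabets_take k As : alphabets As -> alphabets (take k As).
Proof. by move=> h A /mem_take; exact: h. Qed.

Lemma alphabets_drop k As : alphabets As -> alphabets (drop k As).
Proof. by move=> h A /mem_drop; exact: h. Qed.

Lemma wratio_gt0 w As : alphabets As -> fits w As -> 0 < wratio w.
Proof.
elim: w As => [|l w IH] [|A As]//=; first by rewrite wratio_nil.
move=> /alphabets_cons[hA hAs] /andP[lA /(IH _ hAs) w0].
by rewrite wratio_cons mulr_gt0// (alphabet_gt0 hA).
Qed.

Lemma wratio_le_hi w As : alphabets As -> fits w As -> wratio w <= hi ^+ size w.
Proof.
elim: w As => [|l w IH] [|A As]//=; first by rewrite wratio_nil expr0.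
move=> /alphabets_cons[hA hAs] /andP[lA wAs].
rewrite wratio_cons exprS ler_pM ?(ltW (wratio_gt0 hAs wAs)) ?(IH _ hAs wAs)//.
  exact: ltW (alphabet_gt0 hA lA).
by case/andP: (hA.2 _ lA).
Qed.

Lemma stopping_gt0 As t v : alphabets As -> v \in stopping As t -> 0 < wratio v.
Proof.
by move=> hAs /stopping_fits; apply: wratio_gt0; exact: alphabets_take.
Qed.

(** The parent of a stopping word has ratio above t, and the last letter
    multiplies it by at least lo. *)
Lemma stopping_lo As t v : alphabets As -> lo <= 1 -> 0 < t -> t <= 1 ->
  v \in stopping As t -> lo * t <= wratio v.
Proof.
move=> + lo1; elim: As t v => [|A As IH] t v.
  by move=> _ t0 t1; rewrite inE => /eqP->; rewrite wratio_nil mulr_ile1// ltW.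
move=> /alphabets_cons[hA hAs] t0 t1 /=.
case: ifP => [_|_].
  by rewrite inE => /eqP->; rewrite wratio_nil mulr_ile1// ltW.
move=> /flatten_mapP[l lA /mapP[v' v'in ->]].
have l0 := alphabet_gt0 hA lA.
rewrite wratio_cons.
have [tl|/ltW tl] := lerP (t / rho l) 1.
  have := IH _ _ hAs (divr_gt0 t0 l0) tl v'in.
  by rewrite mulrA ler_pdivrMr// [wratio v' * _]mulrC.
have -> : v' = [::].
  by move: v'in; case: (As) => [|? ?] /=; rewrite ?tl inE => /eqP.
rewrite wratio_nil mulr1; case/andP: (hA.2 _ lA) => h _.
by apply: le_trans h; rewrite ler_piMr// ltW.
Qed.

(** The hypothesis on full words rules out branches that are cut only because
    their alphabets are exhausted. *)
Lemma stopping_hi As t v : alphabets As -> (forall w, fits w As -> wratio w <= t) ->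
  v \in stopping As t -> wratio v <= t.
Proof.
elim: As t v => [|A As IH] t v; first by move=> _ /(_ [::] isT) h; rewrite inE => /eqP->.
move=> /alphabets_cons[hA hAs] h /=.
case: ifP => [t1|_]; first by rewrite inE => /eqP->; rewrite wratio_nil.
move=> /flatten_mapP[l lA /mapP[v' v'in ->]].
have l0 := alphabet_gt0 hA lA.
rewrite wratio_cons mulrC -ler_pdivlMr//; apply: IH v'in => // w wAs.
by rewrite ler_pdivlMr// mulrC -wratio_cons; apply: h => /=; rewrite lA.
Qed.

Lemma ordered_le x A y : (forall l, l \in A -> 0 < rho l) -> ordered x A y ->
  x <= y.
Proof.
elim: A x => [|l A IH] x //= h [xl /IH h'].
have := h l; rewrite mem_head => /(_ isT) l0.
apply: (le_trans xl); apply: (@le_trans _ _ (tau l + rho l)); first by rewrite lerDl ltW.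
by apply: h' => l' l'A; apply: h; rewrite inE l'A orbT.
Qed.

Lemma ordered_range x A y l : (forall l, l \in A -> 0 < rho l) -> ordered x A y ->
  l \in A -> x <= tau l /\ tau l + rho l <= y.
Proof.
elim: A x => [|l' A IH] x //= h [xl o].
have hA l0 : l0 \in A -> 0 < rho l0 by move=> l'A; apply: h; rewrite inE l'A orbT.
have l'0 : 0 < rho l' by apply: h; rewrite mem_head.
rewrite inE => /predU1P[->|lA]; first by split => //; exact: ordered_le o.
by have [h1 h2] := IH _ hA o lA; split => //; apply: le_trans h1; lra.
Qed.

Definition separated (v w : seq L) : Prop :=
  wshift v + wratio v <= wshift w \/ wshift w + wratio w <= wshift v.

Lemma ordered_sep x A y l l' : (forall l, l \in A -> 0 < rho l) -> ordered x A y ->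
  l \in A -> l' \in A -> l <> l' ->
  tau l + rho l <= tau l' \/ tau l' + rho l' <= tau l.
Proof.
elim: A x => [|k A IH] x //= h [xl o].
have hA l0 : l0 \in A -> 0 < rho l0 by move=> l'A; apply: h; rewrite inE l'A orbT.
rewrite !inE => /predU1P[->|lA] /predU1P[->|l'A] ll' //.
- by left; have [] := ordered_range hA o l'A.
- by right; have [] := ordered_range hA o lA.
- exact: IH o lA l'A ll'.
Qed.

Lemma ordered_uniq x A y : (forall l, l \in A -> 0 < rho l) -> ordered x A y ->
  uniq A.
Proof.
elim: A x => [|k A IH] x //= h [xl o].
have hA l0 : l0 \in A -> 0 < rho l0 by move=> l'A; apply: h; rewrite inE l'A orbT.
rewrite (IH _ hA o) andbT; apply/negP => kA.
have [+ _] := ordered_range hA o kA.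
by rewrite gerDl leNgt h// mem_head.
Qed.

Lemma alphabet_range A l : alphabet A -> l \in A ->
  0 <= tau l /\ tau l + rho l <= 1.
Proof.
by move=> hA lA; apply: ordered_range hA.1 lA => ? ?; exact: alphabet_gt0 hA _.
Qed.

Lemma wshift_range w As : alphabets As -> fits w As ->
  0 <= wshift w /\ wshift w + wratio w <= 1.
Proof.
elim: w As => [|l w IH] [|A As]//=; first by rewrite wratio_nil; lra.
move=> /alphabets_cons[hA hAs] /andP[lA /(IH _ hAs)[h1 h2]].
have l0 := alphabet_gt0 hA lA; have [h3 h4] := alphabet_range hA lA.
rewrite wratio_cons; split; first by rewrite addr_ge0// mulr_ge0// ltW.
by apply: le_trans h4; rewrite -addrA -mulrDr lerD2l ler_piMr// ltW.
Qed.

(** Two stopping words are not prefixes of each other, so they branch at some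
    position, and there their cylinders go into the disjoint intervals of two
    letters. *)
Lemma stopping_sep As t v w : alphabets As -> v \in stopping As t -> w \in stopping As t ->
  v <> w -> separated v w.
Proof.
elim: As t v w => [|A As IH] t v w.
  by move=> _; rewrite !inE => /eqP-> /eqP->.
move=> /alphabets_cons[hA hAs] /=.
case: ifP => [_|_]; first by rewrite !inE => /eqP-> /eqP->.
move=> /flatten_mapP[l lA /mapP[v' v'in ->]].
move=> /flatten_mapP[l' l'A /mapP[w' w'in ->]].
have l0 := alphabet_gt0 hA lA; have l'0 := alphabet_gt0 hA l'A.
rewrite /separated !wratio_cons /=.
have [ll'|/eqP ll' _] := eqVneq l l'; first rewrite -{}ll' in w'in *.
  have [<- //|/eqP vw _] := eqVneq v' w'.
  by case: (IH _ _ _ hAs v'in w'in vw) => h; [left|right];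
    rewrite -addrA -mulrDr lerD2l ler_pM2l.
have vr := wshift_range (alphabets_take hAs) (stopping_fits v'in).
have wr := wshift_range (alphabets_take hAs) (stopping_fits w'in).
have hl k u : 0 < rho k -> 0 <= wshift u /\ wshift u + wratio u <= 1 ->
    tau k <= tau k + rho k * wshift u /\
    tau k + rho k * wshift u + rho k * wratio u <= tau k + rho k.
  move=> k0 [u1 u2]; split; first by rewrite lerDl mulr_ge0// ltW.
  by rewrite -addrA -mulrDr lerD2l ler_piMr// ltW.
have [h1 h2] := hl l v' l0 vr; have [h3 h4] := hl l' w' l'0 wr.
have hpos k : k \in A -> 0 < rho k by exact: alphabet_gt0 hA.
by case: (ordered_sep hpos hA.1 lA l'A ll') => h5; [left|right]; lra.
Qed.

Lemma stopping_uniq As t : alphabets As -> uniq (stopping As t).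
Proof.
elim: As t => [|A As IH] t //.
move=> /alphabets_cons[hA hAs] /=; case: ifP => // _.
have := ordered_uniq (fun l => alphabet_gt0 hA (l := l)) hA.1.
elim: (A) => //= l A' IHA /andP[lA' uA']; rewrite cat_uniq IHA// andbT.
rewrite map_inj_uniq ?IH//=; last by move=> ? ? [].
apply/hasPn => u /flatten_mapP[l' l'A' /mapP[v _ ->]].
apply/negP => /mapP[v' _ [ll' _]].
by move: lA'; rewrite -ll' l'A'.
Qed.

(** The weight rho ^ beta of a letter is distributed among its successors, so
    the total weight of a cut of the tree is at most that of the root. *)
Lemma stopping_sum_le beta As t : alphabets As ->
  (forall A, A \in As -> \sum_(l <- A) rho l `^ beta <= 1) ->
  \sum_(v <- stopping As t) wratio v `^ beta <= 1.
Proof.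
elim: As t => [|A As IH] t.
  by move=> _ _; rewrite big_seq1 wratio_nil powR1.
move=> /alphabets_cons[hA hAs] h /=.
case: ifP => _; first by rewrite big_seq1 wratio_nil powR1.
rewrite big_flatten big_map; apply: le_trans (h A (mem_head _ _)).
rewrite big_seq_cond [leRHS]big_seq_cond; apply: ler_sum => l /andP[lA _].
have l0 := ltW (alphabet_gt0 hA lA).
rewrite big_map.
rewrite (eq_big_seq (fun v => rho l `^ beta * wratio v `^ beta)); last first.
  by move=> v vin; rewrite wratio_cons powRM// (ltW (stopping_gt0 hAs vin)).
rewrite -big_distrr /= ler_piMr ?powR_ge0// IH// => B BAs.
by apply: h; rewrite inE BAs orbT.
Qed.

Lemma stopping_sum_eq beta As t : alphabets As ->
  (forall A, A \in As -> \sum_(l <- A) rho l `^ beta = 1) ->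
  \sum_(v <- stopping As t) wratio v `^ beta = 1.
Proof.
elim: As t => [|A As IH] t.
  by move=> _ _; rewrite big_seq1 wratio_nil powR1.
move=> /alphabets_cons[hA hAs] h /=.
case: ifP => _; first by rewrite big_seq1 wratio_nil powR1.
rewrite big_flatten big_map -(h A (mem_head _ _)).
apply: eq_big_seq => l lA.
have l0 := ltW (alphabet_gt0 hA lA).
rewrite big_map.
rewrite (eq_big_seq (fun v => rho l `^ beta * wratio v `^ beta)); last first.
  by move=> v vin; rewrite wratio_cons powRM// (ltW (stopping_gt0 hAs vin)).
rewrite -big_distrr /= IH// ?mulr1// => B BAs.
by apply: h; rewrite inE BAs orbT.
Qed.

(** A stopping word weighs at least (lo * t) ^ beta, out of a total of 1.
    Bounding by a number T that is at least 1 covers thresholds above 1, where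
    only the empty word stops. *)
Lemma size_stopping_le beta As t T : alphabets As -> lo <= 1 -> 0 <= beta ->
  (forall A, A \in As -> \sum_(l <- A) rho l `^ beta <= 1) ->
  0 < t -> 1 <= T -> t^-1 <= T ->
  (size (stopping As t))%:R <= (T / lo) `^ beta.
Proof.
move=> hAs lo1 beta0 h t0 T1 tT.
have lo1V : 1 <= T / lo by rewrite ler_pdivlMr// mul1r (le_trans lo1).
have [/ltW t1|t1] := ltrP 1 t.
  have -> : stopping As t = [:: [::]] by case: (As) => //= ? ?; rewrite t1.
  by rewrite -[leLHS](powRr0 (T / lo)) ler_powR.
have p0 : 0 < (lo * t) `^ beta by rewrite powR_gt0// mulr_gt0.
have T0 : 0 < T by lra.
rewrite -(ler_pM2r p0) -powRM; [|by rewrite divr_ge0 ?ltW|by rewrite mulr_ge0 ?ltW].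
have -> : T / lo * (lo * t) = T * t by rewrite mulrA divfK ?gt_eqF.
apply: (@le_trans _ _ 1); last first.
  rewrite -[leLHS](powRr0 (T * t)) ler_powR//.
  by rewrite -ler_pdivrMr// mul1r.
apply: le_trans (stopping_sum_le t hAs h).
rewrite -sum1_size natr_sum mulr_suml big_seq [leRHS]big_seq.
apply: ler_sum => v vin; rewrite mul1r ge0_ler_powR// ?nnegrE.
- by rewrite mulr_ge0// ltW.
- exact: ltW (stopping_gt0 hAs vin).
- exact: stopping_lo vin.
Qed.

(** A stopping word weighs at most t ^ beta, and the total is 1. *)
Lemma size_stopping_ge beta As t : alphabets As -> 0 <= beta -> 0 < t ->
  (forall A, A \in As -> \sum_(l <- A) rho l `^ beta = 1) ->
  (forall w, fits w As -> wratio w <= t) ->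
  t^-1 `^ beta <= (size (stopping As t))%:R.
Proof.
move=> hAs beta0 t0 h ht.
rewrite -[leLHS]mulr1 -[X in _ * X <= _](stopping_sum_eq t hAs h) -sum1_size natr_sum mulr_sumr.
rewrite big_seq [leRHS]big_seq; apply: ler_sum => v vin.
have v0 := stopping_gt0 hAs vin.
rewrite -powRM ?invr_ge0 ?(ltW t0) ?(ltW v0)//.
rewrite -[leRHS](_ : 1 `^ beta = 1); last by rewrite powR1.
rewrite ge0_ler_powR// ?nnegrE ?mulr_ge0 ?invr_ge0 ?(ltW t0) ?(ltW v0)//.
by rewrite mulrC ler_pdivrMr// mul1r (stopping_hi hAs ht).
Qed.

(** Dividing by lam and truncating is injective on values that are lam apart. *)
Lemma size_separated (T : eqType) (s : seq T) (g : T -> R) (x lam M : R) :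
  0 < lam -> 0 <= M -> uniq s ->
  (forall p, p \in s -> x <= g p <= x + M * lam) ->
  (forall p p', p \in s -> p' \in s -> p <> p' -> lam <= `|g p - g p'|) ->
  (size s)%:R <= M + 1.
Proof.
move=> lam0 M0 us hr hs.
pose q p := Num.truncn ((g p - x) / lam).
have qP p : p \in s -> (q p)%:R <= (g p - x) / lam < (q p).+1%:R.
  move=> /hr/andP[h _]; apply: Num.Theory.truncn_itv.
  by rewrite divr_ge0 ?subr_ge0// ltW.
have uq : uniq (map q s).
  rewrite map_inj_in_uniq// => p p' ps ps' qpp'.
  apply: contrapT => pp'; have := hs p p' ps ps' pp'.
  apply/negP; rewrite -ltNge.
  have /andP[] := qP p ps; have /andP[] := qP p' ps'; rewrite qpp'.
  rewrite !ler_pdivlMr// !ltr_pdivrMr// -natr1 ltr_norml; nra.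
have sub : {subset map q s <= iota 0 (Num.truncn M).+1}.
  move=> _ /mapP[p ps ->]; rewrite mem_iota /= add0n ltnS; apply: le_truncn.
  by rewrite ler_pdivrMr// lerBlDl; case/andP: (hr _ ps).
have := uniq_leq_size uq sub; rewrite size_map size_iota => h.
apply: (@le_trans _ _ (Num.truncn M).+1%:R); first by rewrite ler_nat.
by rewrite -natr1 lerD2r truncn_le.
Qed.

(** If the first interval starts at x it can be removed without changing the
    missing length; otherwise there is a gap before it. *)
Lemma ordered_gap x A y : (forall l, l \in A -> 0 < rho l) -> ordered x A y ->
  x + \sum_(l <- A) rho l < y ->
  exists g h : R, [/\ x <= g, g < h, h <= y &
    forall l, l \in A -> tau l + rho l <= g \/ h <= tau l].
Proof.
elim: A x => [|l A IH] x /= h.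
  by rewrite big_nil addr0 => _ xy; exists x, y; split.
move=> [xl o]; rewrite big_cons => hs.
have hA k : k \in A -> 0 < rho k by move=> kA; apply: h; rewrite inE kA orbT.
have [xl'|] := ltrP x (tau l).
  exists x, (tau l); split => //.
    have [_] := @ordered_range x (l :: A) y l h (conj xl o) (mem_head _ _).
    by have := h l (mem_head _ _); lra.
  move=> k; rewrite inE => /predU1P[->|kA]; first by right.
  right; have [+ _] := ordered_range hA o kA; have := h l (mem_head _ _); lra.
move=> lx; have {lx xl}xE : x = tau l by apply/eqP; rewrite eq_le xl lx.
have [|g [h' [h1 h2 h3 h4]]] := IH _ hA o; first by rewrite -xE -addrA.
exists g, h'; split => //; first by have := h l (mem_head _ _); lra.
by move=> k; rewrite inE => /predU1P[->|]; [left|exact: h4].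
Qed.

Lemma ordered_sum_le x A y : ordered x A y -> x + \sum_(l <- A) rho l <= y.
Proof.
elim: A x => [|l A IH] x /=; first by rewrite big_nil addr0.
by move=> [xl /IH]; rewrite big_cons; lra.
Qed.

Lemma ordered_cover x A y z : ordered x A y -> x + \sum_(l <- A) rho l = y ->
  x < y -> x <= z <= y ->
  exists2 l, l \in A & tau l <= z <= tau l + rho l.
Proof.
elim: A x => [|l A IH] x /=; first by rewrite big_nil addr0; lra.
move=> [xl o]; rewrite big_cons => hs xy /andP[xz zy].
have xE : x = tau l by apply/eqP; rewrite eq_le xl; have := ordered_sum_le o; lra.
have [zl|lz] := lerP z (tau l + rho l).
  by exists l; rewrite ?mem_head// zl andbT -xE.
have [|||k kA hk] := IH _ o; [lra|lra|by apply/andP; split; lra|].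
by exists k => //; rewrite inE kA orbT.
Qed.

Definition full A : Prop := \sum_(l <- A) rho l = 1.

(** Intervals of total length 1 leave no gap, so points of [0, 1] have
    addresses of any length. *)
Lemma full_cover As z : alphabets As -> (forall A, A \in As -> full A) ->
  0 <= z <= 1 -> exists2 w, fits w As & wshift w <= z <= wshift w + wratio w.
Proof.
elim: As z => [|A As IH] z; first by exists [::] => //=; rewrite wratio_nil add0r.
move=> /alphabets_cons[hA hAs] hf z01.
have [||l lA hl] := ordered_cover hA.1 _ _ z01; [|exact: ltr01|].
  by rewrite add0r hf// mem_head.
have l0 := alphabet_gt0 hA lA.
have [//|||w wAs hw] := IH ((z - tau l) / rho l).
- by move=> B BAs; apply: hf; rewrite inE BAs orbT.
- by rewrite ler_pdivlMr// ler_pdivrMr//; lra.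
exists (l :: w) => /=; first by rewrite lA.
move: hw; rewrite ler_pdivlMr// ler_pdivrMr// wratio_cons; nra.
Qed.

Lemma wratio_nseq k l : wratio (nseq k l) = rho l ^+ k.
Proof. by elim: k => [|k IH]; rewrite ?wratio_nil// /= wratio_cons IH exprS. Qed.

(** The left one of two letters followed by the right one keeps away from both
    ends of [0, 1]. Appended to stopping words, this word turns cylinders that
    may touch into cylinders separated by a fixed proportion of their lengths.
    *)
Lemma inner_word A l l' : lo <= 1 -> alphabet A -> l \in A -> l' \in A -> l <> l' ->
  exists sfx, [/\ fits sfx [:: A; A], lo ^+ 2 <= wshift sfx &
    wshift sfx + wratio sfx <= 1 - lo ^+ 2].
Proof.
move=> lo1 hA.
wlog: l l' / tau l + rho l <= tau l'.
  move=> h lA l'A ll'; have hpos k : k \in A -> 0 < rho k by exact: alphabet_gt0 hA.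
  have [h1|h1] := ordered_sep hpos hA.1 lA l'A ll'; first exact: h h1 lA l'A ll'.
  by apply: (h _ _ h1 l'A lA) => e; exact: ll'.
move=> h lA l'A _; exists [:: l; l']; rewrite /= lA l'A; split => //.
  have [h1 _] := alphabet_range hA lA; have [_ /(_ l lA)/andP[h2 _]] := hA.
  have := lo_gt0; nra.
have [h1 _] := alphabet_range hA lA; have [_ h3] := alphabet_range hA l'A.
have [_ /(_ l' l'A)/andP[h4 _]] := hA; have l0 := alphabet_gt0 hA lA.
have l2 : lo ^+ 2 <= lo by rewrite expr2 ler_piMr// ltW.
rewrite 2!wratio_cons wratio_nil; nra.
Qed.

(** The length of the gap is a parameter, so that finitely many alphabets can
    share it. *)
Definition gapped (gam : R) A : Prop := exists g : R,
  [/\ 0 <= g, g + gam <= 1 & forall l, l \in A -> tau l + rho l <= g \/ g + gam <= tau l].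

Lemma gappedW gam gam' A : gam' <= gam -> gapped gam A -> gapped gam' A.
Proof.
move=> le [g [g0 g1 h]]; exists g; split => //; first lra.
by move=> l /h[|]; [left|right; lra].
Qed.

Lemma sum_lt1_gapped A : alphabet A -> \sum_(l <- A) rho l < 1 ->
  exists2 gam : R, 0 < gam & gapped gam A.
Proof.
move=> hA sA; have hpos l : l \in A -> 0 < rho l by exact: alphabet_gt0 hA.
have [|g [h [g0 gh h1 hl]]] := ordered_gap hpos hA.1; first by rewrite add0r.
exists (h - g); first by rewrite subr_gt0.
by exists g; split => // [|l /hl[|]]; [lra|left|right; lra].
Qed.

End Line.

(** * Porosity *)

Section Porosity.
Context {R : realType} {L : eqType} (rho tau : L -> R).
Context (lo hi : R) (lo_gt0 : 0 < lo).
Implicit Types (l : L) (v w : seq L) (A : seq L) (As : seq (seq L)) (p q gam : R).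
Local Notation wratio := (wratio rho).
Local Notation wshift := (wshift rho tau).
Local Notation cylinder := (cylinder rho tau).
Local Notation stopping := (stopping rho).
Local Notation alphabet := (alphabet rho tau lo hi).
Local Notation alphabets := (alphabets rho tau lo hi).

Definition avoids p q As : Prop :=
  forall w x, fits w As -> cylinder w x -> ~ (p < x < q).

Lemma avoidsW p q p' q' As : p <= p' -> q' <= q -> avoids p q As -> avoids p' q' As.
Proof.
by move=> pp qq h w x wA xw /andP[px xq]; apply: (h w x wA xw); apply/andP; split; lra.
Qed.

(** If some stopping word of length about (q - p) / 4 has a cylinder that
    meets the middle half of [p, q], this cylinder lies in [p, q]; it contains
    a scaled copy of the gap of the alphabet that comes next, and no other
    cylinder enters it. If there is no such word, the middle half itself is
    free. The final alphabet A guarantees that a stopping word over As has a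
    next alphabet. *)
Lemma porous gam As A p q : alphabets (rcons As A) -> lo <= 1 -> 0 < gam ->
  (forall B, B \in rcons As A -> gapped rho tau gam B) ->
  p < q -> q - p <= 1 ->
  (forall w, fits w As -> wratio w <= (q - p) / 4) ->
  exists p' q' : R, [/\ p <= p', q' <= q, q' - p' = gam * lo / 4 * (q - p) &
    avoids p' q' (rcons As A)].
Proof.
have lo0 : 0 < lo by exact: lo_gt0.
move=> hAs lo1 gam0 hg pq pq1 ht.
have [g0 [g00 g01 _]] : gapped rho tau gam A by apply: hg; rewrite mem_rcons mem_head.
have hAs0 : alphabets As.
  by move=> B BA; apply: hAs; rewrite mem_rcons inE BA orbT.
have glo : gam * lo <= 1 by rewrite mulr_ile1//; lra.
pose t := (q - p) / 4; have t0 : 0 < t by rewrite /t; lra.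
have t1 : t <= 1 by rewrite /t; lra.
have hpre w : fits w (rcons As A) -> exists v l w',
    [/\ v \in stopping As t, w = v ++ l :: w', l \in nth [::] (rcons As A) (size v) &
      fits w' (drop (size v).+1 (rcons As A))].
  move=> wA; have := fits_take (size As) wA.
  rewrite -[rcons As A]cats1 take_size_cat// => wA0.
  have [v vc [w' wE]] := stopping_prefix rho t wA0.
  have szv : (size v <= size As)%N.
    by rewrite -(fits_size wA0) wE size_cat leq_addr.
  exists v; have wE2 : w = v ++ (w' ++ drop (size As) w).
    by rewrite catA -wE cat_take_drop.
  have := fits_drop (size v) wA; rewrite {1}wE2 drop_size_cat//.
  rewrite (drop_nth [::]) ?size_rcons ?ltnS// cats1.
  case: (w' ++ _) wE2 => [|l w''] //= -> /andP[h1 h2].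
  by exists l, w''.
have hcyl w v l w' : w = v ++ l :: w' -> v \in stopping As t ->
   l \in nth [::] (rcons As A) (size v) ->
   fits w' (drop (size v).+1 (rcons As A)) ->
   forall x, cylinder w x ->
     wshift v + wratio v * tau l <= x <= wshift v + wratio v * (tau l + rho l) /\
     wshift v <= x <= wshift v + wratio v.
  move=> -> vc lB w'D x.
  have v0 : 0 < wratio v := stopping_gt0 lo_gt0 hAs0 vc.
  have szv : (size v <= size As)%N.
    by have := fits_size (stopping_fits vc); rewrite size_take; case: ltnP => [/ltnW|_ ->].
  have hB : alphabet (nth [::] (rcons As A) (size v)).
    by apply: hAs; apply: mem_nth; rewrite size_rcons ltnS.
  have l0 := alphabet_gt0 lo_gt0 hB lB.
  have [r1 r2] := alphabet_range lo_gt0 hB lB.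
  have [s1 s2] := wshift_range lo_gt0 (alphabets_drop (k:=(size v).+1) hAs) w'D.
  rewrite /cylinder /= in_itv /= wshift_cat wratio_cat /= wratio_cons => /andP[h1 h2].
  have e1 : 0 <= rho l * wshift w' by rewrite mulr_ge0 ?(ltW l0).
  have e2 : rho l * wshift w' + rho l * wratio w' <= rho l.
    by rewrite -mulrDr ler_piMr ?(ltW l0).
  split; apply/andP; split; nra.
have [[v vc [z /andP[z1 z2] /andP[z3 z4]]]|hno] := pselect (exists2 v, v \in stopping As t &
    exists2 z, p + t <= z <= q - t & wshift v <= z <= wshift v + wratio v); last first.
  exists (p + t), (p + t + gam * lo / 4 * (q - p)); split; [lra| |lra|].
    by rewrite /t in t0 *; nra.
  move=> w x /hpre[v [l [w' [vc wE lB w'D]]]] xw /andP[x1 x2].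
  have [_ h] := hcyl _ _ _ _ wE vc lB w'D x xw.
  apply: hno; exists v => //; exists x => //.
  by apply/andP; split; [lra|rewrite /t in t0 x2 *; nra].
have v0 : 0 < wratio v := stopping_gt0 lo_gt0 hAs0 vc.
have vt : wratio v <= t := stopping_hi lo_gt0 hAs0 ht vc.
have tv : lo * t <= wratio v := stopping_lo lo_gt0 hAs0 lo1 t0 t1 vc.
have szv : (size v <= size As)%N.
  by have := fits_size (stopping_fits vc); rewrite size_take; case: ltnP => [/ltnW|_ ->].
have [g [gge0 g1 hB]] : gapped rho tau gam (nth [::] (rcons As A) (size v)).
  by apply: hg; apply: mem_nth; rewrite size_rcons ltnS.
have eL : gam * lo / 4 * (q - p) = gam * (lo * t) by rewrite /t; field.
have pt : q - p = 4 * t by rewrite /t; field.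
have gv : gam * (lo * t) <= gam * wratio v by rewrite ler_pM2l.
have vg : wratio v * (g + gam) <= wratio v by rewrite ler_piMr ?(ltW v0).
have vg0 : 0 <= wratio v * g by rewrite mulr_ge0 ?(ltW v0).
exists (wshift v + wratio v * g), (wshift v + wratio v * g + gam * (lo * t)).
split; [lra|lra|lra|].
move=> w x /hpre[v2 [l [w' [vc2 wE lB w'D]]]] xw /andP[x1 x2].
have [/andP[h1 h2] /andP[h3 h4]] := hcyl _ _ _ _ wE vc2 lB w'D x xw.
have [e|/eqP ne] := eqVneq v2 v.
  rewrite {}e in h1 h2 lB; have [h5|h5] := hB _ lB.
    have : wratio v * (tau l + rho l) <= wratio v * g by rewrite ler_pM2l.
    lra.
  have : wratio v * (g + gam) <= wratio v * tau l by rewrite ler_pM2l.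
  lra.
case: (stopping_sep lo_gt0 hAs0 vc2 vc ne) => h5; lra.
Qed.

(** The gaps of the families are found one inside the other. Each family costs
    a factor gam * lo / 4, so a bounded number of them leaves a gap of
    comparable length avoided by all. *)
Lemma porous_seq gam (Fs : seq (seq (seq L))) p q : lo <= 1 -> 0 < gam -> gam <= 1 ->
  p < q -> q - p <= 1 ->
  (forall As, As \in Fs -> alphabets As /\ (forall A, A \in As -> gapped rho tau gam A)) ->
  (forall As, As \in Fs -> exists As0 A, As = rcons As0 A /\
     forall w, fits w As0 -> wratio w <= (gam * lo / 4) ^+ size Fs * (q - p) / 4) ->
  exists p' q' : R, [/\ p <= p', q' <= q, q' - p' = (gam * lo / 4) ^+ size Fs * (q - p) &
    forall As, As \in Fs -> avoids p' q' As].
Proof.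
have lo0 : 0 < lo by exact: lo_gt0.
move=> lo1 gam0 gam1; pose k := gam * lo / 4.
have k0 : 0 < k by rewrite /k divr_gt0// mulr_gt0.
have k1 : k <= 1.
  have : gam * lo <= 1 by rewrite mulr_ile1// ltW.
  rewrite /k; lra.
rewrite -/k; elim: Fs p q => [|As Fs IH] p q pq pq1 hA hw.
  by exists p, q; split => //; rewrite expr0 mul1r.
have [As0 [A [AsE hAs0]]] := hw _ (mem_head _ _).
have kn : k ^+ size (As :: Fs) <= k by rewrite /= exprS ler_piMr ?exprn_ile1 ?(ltW k0).
have [hAs hgA] := hA _ (mem_head _ _); rewrite AsE in hAs hgA.
have hrat w : fits w As0 -> wratio w <= (q - p) / 4.
  move=> /hAs0 h; apply: (le_trans h); rewrite ler_pM2r ?invr_gt0//.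
  by rewrite ler_piMl ?subr_ge0 ?(ltW pq)// (le_trans kn).
have [p1 [q1 [h1 h2 h3 h4]]] := porous hAs lo1 gam0 hgA pq pq1 hrat.
rewrite -/k in h3.
have h5 : q1 - p1 <= q - p by rewrite h3 ler_piMl// subr_ge0 ltW.
have h6 : p1 < q1 by rewrite -subr_gt0 h3 mulr_gt0// subr_gt0.
have [||p2 [q2 [h7 h8 h9 h10]]] := IH p1 q1 h6 (le_trans h5 pq1).
- by move=> Bs BF; apply: hA; rewrite inE BF orbT.
- move=> Bs BF; have [|Bs0 [B [BE hB]]] := hw Bs; first by rewrite inE BF orbT.
  exists Bs0, B; split => // w /hB h; apply: (le_trans h).
  by rewrite h3 /= exprS; lra.
exists p2, q2; split; [lra|lra| |].
  by rewrite h9 h3 /= exprS; ring.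
move=> Bs; rewrite inE => /predU1P[->|]; last exact: h10.
by rewrite AsE; apply: avoidsW h4.
Qed.

End Porosity.

(** * Packing of weighted points *)

Section Metric.
Context {R : realType}.

(** A ball of radius r contains at most one of the points. *)
Lemma packing (Y : metricType R) (I : finType) (T : {pred I}) (g : I -> Y)
    (s : seq Y) (r : R) :
  (forall i, i \in T -> (\bigcup_(y in [set` s]) ball y r) (g i)) ->
  (forall i j, i \in T -> j \in T -> i != j -> 2 * r <= mdist (g i) (g j)) ->
  (#|T| <= size s)%N.
Proof.
move=> hc hs.
have /choice[h hP] : forall i, exists y, i \in T -> y \in s /\ mdist y (g i) < r.
  move=> i; have [iT|iT] := boolP (i \in T); last by exists (g i).
  by have [y ys /=] := hc i iT; rewrite ballEmdist /= => yr; exists y.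
rewrite cardE -(size_map h); apply: uniq_leq_size.
  rewrite map_inj_in_uniq ?enum_uniq// => i j; rewrite !mem_enum => iT jT hij.
  apply/eqP; apply: contraT => ij; have := hs i j iT jT ij.
  have [_ hi] := hP i iT; have [_ hj] := hP j jT.
  have := metric_triangle (g i) (h i) (g j); rewrite (metric_sym (g i) (h i)) {2}hij; lra.
by move=> _ /mapP[i + ->]; rewrite mem_enum => /hP[].
Qed.

(** A number not exceeding 2 ^ J * t is at most t plus the sum of those powers
    2 ^ j * t, j < J, that it reaches. *)
Lemma sum_layers (I : finType) (delta : I -> R) (t : R) (J : nat) : 0 < t ->
  (forall i, delta i <= 2 ^+ J * t) ->
  \sum_i delta i <= #|I|%:R * t +
    \sum_(j < J) (2 ^+ j * t) * #|[pred i | 2 ^+ j * t <= delta i]|%:R.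
Proof.
move=> t0 hd.
have pt i n : delta i <= 2 ^+ n * t ->
    delta i <= t + \sum_(j < n) (2 ^+ j * t) * (2 ^+ j * t <= delta i)%R%:R.
  elim: n => [|n IH]; first by rewrite expr0 mul1r big_ord0 addr0.
  rewrite big_ord_recr /=; case: (lerP (2 ^+ n * t) (delta i)) => hn; last first.
    by move=> _; rewrite mulr0 addr0; apply: IH; exact: ltW.
  rewrite mulr1 => /le_trans; apply.
  rewrite (_ : \sum_(j < n) _ = \sum_(j < n) ((2 : R) ^+ j * t)); last first.
    apply: eq_bigr => j _; rewrite (_ : _ <= _ = true) ?mulr1//.
    apply: le_trans hn; rewrite ler_pM2r// ler_weXn2l ?ler1n//.
    exact: ltnW (ltn_ord j).
  have : \sum_(j < n) ((2 : R) ^+ j * t) = 2 ^+ n * t - t :> R.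
    elim: (n) => [|k IHk]; first by rewrite big_ord0 expr0; lra.
    by rewrite big_ord_recr /= IHk exprS; lra.
  by rewrite exprS => ->; lra.
apply: (@le_trans _ _ (\sum_i (t + \sum_(j < J) (2 ^+ j * t) * (2 ^+ j * t <= delta i)%R%:R))).
  by apply: ler_sum => i _; exact: pt.
rewrite big_split /= sumr_const cardE -cardT mulr_natl lerD2l exchange_big /=.
apply: ler_sum => j _; rewrite -mulr_sumr -natr_sum.
rewrite (_ : (\sum_i _)%N = #|[pred i | 2 ^+ j * t <= delta i]|)//.
rewrite -sum1_card [RHS]big_mkcond /=.
by apply: eq_bigr => i _; rewrite inE; case: (_ <= _)%R.
Qed.

(** A point g i is isolated from the others in proportion to its weight delta
    i. Those of weight at least th are th / H-separated, so the Assouad bound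
    limits their number to a multiple of (D / th) ^ alpha. Summing over th = 2
    ^ j * t gives a geometric series, which for alpha > 1 is dominated by its
    first term, the one of the smallest weight t. *)
Lemma weighted_packing (Y : metricType R) (alpha H : R) :
  1 < alpha -> 1 <= H -> assouad_bound Y alpha ->
  exists2 C1, 0 < C1 & forall (I : finType) (g : I -> Y) (delta : I -> R) (D t : R) (x0 : Y),
    0 < D -> (D%:E <= diam Y)%E -> 0 < t ->
    (forall i, mdist x0 (g i) < 2 * D) ->
    (forall i, delta i <= 2 * D) ->
    (forall i j, i != j -> delta i <= H * mdist (g i) (g j)) ->
    \sum_i delta i <= #|I|%:R * t + C1 * D `^ alpha * (t * t `^ (- alpha)).
Proof.
move=> a1 H1 [C0 C00 hC].
pose q : R := 2 * 2 `^ (- alpha).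
have q1 : q < 1.
  rewrite /q powRN ltr_pdivrMr ?powR_gt0// mul1r -mulr_powRB1//; last lra.
  rewrite -[ltLHS]mulr1 ltr_pM2l// -[ltLHS](_ : 1 `^ (alpha - 1) = 1); last by rewrite powR1.
  by rewrite gt0_ltr_powR ?nnegrE//; lra.
exists (C0 * (4 * H) `^ alpha / (1 - q)).
  by rewrite divr_gt0 ?mulr_gt0 ?powR_gt0 ?subr_gt0//; lra.
move=> I g delta D t x0 D0 Ddiam t0 hball hd hsep.
have count (th : R) : 0 < th -> #|[pred i | th <= delta i]|%:R * th `^ alpha <=
    C0 * (4 * H * D) `^ alpha.
  move=> th0; have rhs0 : 0 <= C0 * (4 * H * D) `^ alpha.
    by rewrite mulr_ge0 ?powR_ge0 ?ltW.
  have [thD|thD] := ltrP (2 * D) th.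
    rewrite (_ : #|_| = 0%N) ?mul0r//.
    apply: eq_card0 => i; rewrite !inE; apply/negbTE; rewrite -ltNge.
    exact: le_lt_trans (hd i) thD.
  have [|||s [hs1 hs2]] := hC (th / (2 * H)) (2 * D) _ _ _ x0.
  - by rewrite divr_gt0//; lra.
  - rewrite ler_pdivrMr; last lra.
    by rewrite (_ : 2 * D / 2 = D); [nra|field].
  - by rewrite (_ : 2 * D / 2 = D)//; field.
  have h : (#|[pred i | th <= delta i]|%:R : R) <= (size s)%:R.
    rewrite ler_nat; apply: (@packing _ _ _ g s (th / (2 * H))).
      by move=> i _; apply: hs2; rewrite ballEmdist /=.
    move=> i j; rewrite !inE => hi _ ij.
    have := hsep i j ij => hij.
    rewrite (_ : 2 * (th / (2 * H)) = th / H); last by field; lra.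
    rewrite ler_pdivrMr; last lra.
    by rewrite mulrC; exact: le_trans hi hij.
  have := le_trans h hs1; rewrite -(ler_pM2r (powR_gt0 alpha th0)) => /le_trans; apply.
  rewrite -[leLHS]mulrA -powRM ?(ltW th0)//; last first.
    by rewrite divr_ge0 ?divr_ge0//; lra.
  by rewrite (_ : 2 * D / (th / (2 * H)) * th = 4 * H * D)//; field; lra.
have [J hJ] : exists J, 2 * D <= 2 ^+ J * t.
  have [J hJ] : exists J : nat, 2 * D / t <= J%:R.
    by exists (Num.truncn (2 * D / t)).+1; apply: ltW; apply: truncnS_gt.
  exists J; rewrite -ler_pdivrMr//; apply: (le_trans hJ).
  by rewrite -natrX ler_nat ltnW// ltn_expl.
apply: (le_trans (sum_layers t0 _)) => [i|]; first exact: le_trans (hd i) hJ.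
rewrite lerD2l.
pose u th : R := th * th `^ (- alpha).
have u2 th : 0 < th -> u (2 * th) = q * u th.
  by move=> th0; rewrite /u powRM ?ltW// /q; ring.
have u0 th : 0 < th -> 0 < u th by move=> th0; rewrite mulr_gt0// powR_gt0.
have su n : (1 - q) * \sum_(j < n) u (2 ^+ j * t) = u t - u (2 ^+ n * t).
  elim: n => [|n IH]; first by rewrite big_ord0 expr0 mul1r mulr0 subrr.
  rewrite big_ord_recr /= mulrDr IH exprS -mulrA u2 ?mulr_gt0 ?exprn_gt0//.
  by ring.
apply: (@le_trans _ _ (C0 * (4 * H * D) `^ alpha * \sum_(j < J) u (2 ^+ j * t))).
  rewrite mulr_sumr; apply: ler_sum => j _.
  have th0 : 0 < 2 ^+ j * t by rewrite mulr_gt0// exprn_gt0.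
  rewrite /u [leRHS]mulrCA ler_pM2l// -[leLHS]mulr1.
  rewrite -(ler_pM2r (powR_gt0 alpha th0)) mulr1 (le_trans (count _ th0))//.
  rewrite -[leRHS]mulrA -powRD ?addNr ?powRr0 ?mulr1//.
  by rewrite (gt_eqF th0) implybT.
rewrite powRM ?(ltW D0)//; last lra.
rewrite -/(u t); set K := _ `^ _; set E := D `^ _.
have -> : C0 * K / (1 - q) * E * u t = C0 * (K * E) * (u t / (1 - q)) by ring.
rewrite ler_wpM2l ?mulr_ge0 ?powR_ge0 ?(ltW C00)//.
rewrite ler_pdivlMr ?subr_gt0// mulrC su gerBl ltW// u0// mulr_gt0// exprn_gt0//.
Qed.

End Metric.

(** * Ladders and quasi-symmetric maps *)

Section Ladders.
Context {R : realType}.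

(** The control function is continuous, hence bounded on [0, M]. *)
Lemma quasisymmetric_le (X Y : metricType R) (f : X -> Y) (M : R) :
  quasisymmetric f -> 0 <= M ->
  injective f /\ exists2 H, 1 <= H & forall x a b, x <> b ->
    mdist x a <= M * mdist x b -> mdist (f x) (f a) <= H * mdist (f x) (f b).
Proof.
move=> [[g [_ _ fK _ _]] [eta [_ [_ _ _ _ [etac _]]] hqs]] M0.
have finj : injective f.
  by move=> x y fxy; rewrite -[x]fK ?in_setT// fxy fK ?in_setT.
split=> //.
have [|c cM hc] := @EVT_max R eta 0 M M0.
  apply: continuous_subspaceW etac => t /=.
  by rewrite !in_itv /= andbT => /andP[].
exists (Num.max 1 (eta c)) => [|x a b xb hab]; first by rewrite le_max lexx.
have fxb : 0 < mdist (f x) (f b) by rewrite mdist_gt0; apply/eqP => /finj.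
have xb0 : 0 < mdist x b by rewrite mdist_gt0; apply/eqP.
rewrite -ler_pdivrMr//; apply: (le_trans (hqs x a b xb)).
rewrite le_max; apply/orP; right; apply: hc.
by rewrite in_itv /= divr_ge0 ?mdist_ge0//= ler_pdivrMr.
Qed.

(** At resolution N, a discrete model of the product of an interval with a set
    of dimension s: at least N ^ s paths, each with N steps of size about r
    that carry it to a distance about N * r, all points being separated by
    about r. The quality is measured by c and C, which have to be uniform in
    N. *)
Definition ladder (X : metricType R) (s c C : R) (N : nat) : Prop :=
  exists (K : nat) (r : R) (p : 'I_K -> nat -> X),
    [/\ 0 < r, N%:R `^ s <= K%:R,
     (forall k k' l l', (l <= N)%N -> (l' <= N)%N -> (k, l) != (k', l') ->
        c * r <= mdist (p k l) (p k' l')),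
     (forall k l, (l < N)%N -> mdist (p k l) (p k l.+1) <= C * r) &
     (forall k, c * (N%:R * r) <= mdist (p k 0) (p k N)) /\
     (forall k k' l l', (l <= N)%N -> (l' <= N)%N ->
        mdist (p k l) (p k' l') <= C * (N%:R * r))].

Lemma path_triangle (Y : metricType R) (q : nat -> Y) N :
  mdist (q 0) (q N) <= \sum_(l < N) mdist (q l) (q l.+1).
Proof.
elim: N => [|N IH]; first by rewrite big_ord0 mdistxx.
rewrite big_ord_recr /=; apply: le_trans (metric_triangle _ (q N) _) _.
by rewrite lerD2r.
Qed.

(** The images of the paths all have endpoints at distance comparable to the
    diameter D of the image of the ladder, because the ladder itself has this
    property; so the image steps have total length at least about N ^ s * D.
    An image step is at most a constant times the distance of its origin to
    any other image point, so the total length of the steps is at most a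
    constant times D * N ^ (alpha - 1) by packing. *)
Lemma ladder_sum (X Y : metricType R) (f : X -> Y) (s c C alpha : R) :
  0 < c -> 0 < C -> quasisymmetric f -> 1 < alpha -> assouad_bound Y alpha ->
  exists2 C2, 0 < C2 & forall N, (0 < N)%N -> ladder X s c C N ->
    N%:R `^ s <= C2 * N%:R `^ (alpha - 1).
Proof.
move=> c0 C0 qsf a1 hY.
have [finj [H H1 hH]] := quasisymmetric_le qsf (ltW (divr_gt0 C0 c0)).
have [C1 C10 hW] := weighted_packing a1 H1 hY.
have H0 : 0 < H by lra.
have H4 : 0 < 4 * H by lra.
exists (C1 * (4 * H) * (4 * H) `^ (alpha - 1)).
  by rewrite !mulr_gt0// powR_gt0.
move=> N N0 [K [r [p [r0 NK psep pstep [plen pbnd]]]]].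
have NR0 : 0 < N%:R :> R by rewrite ltr0n.
have K0 : (0 < K)%N.
  by rewrite -(ltr0n R); apply: lt_le_trans NK; rewrite powR_gt0.
pose k0 := Ordinal K0; pose x0 := f (p k0 0).
pose I : finType := ('I_K * 'I_N.+1)%type.
pose i0 : I := (k0, ord0).
pose dd (i : I) := mdist x0 (f (p i.1 i.2)).
have [im _ him] := @Order.TotalTheory.arg_maxP _ _ I i0 xpredT dd isT.
pose D := dd im.
have dD i : dd i <= D by exact: him.
have ne k k' l l' : (l <= N)%N -> (l' <= N)%N -> (k, l) != (k', l') ->
    p k l <> p k' l'.
  move=> lN l'N ne pp; have := psep _ _ _ _ lN l'N ne; rewrite pp mdistxx.
  by rewrite leNgt mulr_gt0.
have cmp M (x a b : R) : x <= C * M -> c * M <= b -> x <= C / c * b.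
  move=> h1 h2; apply: (le_trans h1); rewrite -mulrA ler_pM2l//.
  by rewrite mulrC ler_pdivlMr// mulrC.
have D0 : 0 < D.
  apply: lt_le_trans (dD (k0, ord_max)); rewrite /dd mdist_gt0.
  apply/eqP => /finj; apply: ne => //=.
  by rewrite xpair_eqE eqxx /= eq_sym -lt0n.
have DY : (D%:E <= diam Y)%E.
  by apply: ereal_sup_ubound => /=; exists (x0, f (p im.1 im.2)).
(* Up to a constant, the ends of a path are as far apart as any two points of
   the ladder, and quasi-symmetry transports this to the image. *)
have long k : D <= 2 * H * mdist (f (p k 0)) (f (p k N)).
  have h q : mdist (p k 0) q <= C * (N%:R * r) ->
      mdist (f (p k 0)) (f q) <= H * mdist (f (p k 0)) (f (p k N)).
    move=> hq; apply: hH; last exact: cmp hq (plen k).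
    by apply: ne => //; rewrite xpair_eqE eqxx /= eq_sym -lt0n.
  have := metric_triangle x0 (f (p k 0)) (f (p im.1 im.2)).
  rewrite -/(dd im) -/D (metric_sym x0).
  have := h (p k0 0) (pbnd _ _ _ _ (leq0n _) (leq0n _)).
  have := h (p im.1 im.2) (pbnd _ _ _ _ (leq0n _) (ltn_ord im.2)).
  by rewrite /x0; lra.
pose g (j : 'I_K * 'I_N) := f (p j.1 j.2).
pose delta (j : 'I_K * 'I_N) := mdist (g j) (f (p j.1 j.2.+1)).
(* Steps shorter than t contribute at most half of the total length. *)
pose t := D / (4 * H * N%:R).
have t0 : 0 < t by rewrite divr_gt0// !mulr_gt0//; lra.
have hball k l : (l <= N)%N -> mdist x0 (f (p k l)) <= D.
  by move=> lN; have := dD (k, Ordinal (lN : (l < N.+1)%N)).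
have hle : \sum_j delta j <= #|{: 'I_K * 'I_N}|%:R * t +
    C1 * D `^ alpha * (t * t `^ (- alpha)).
  apply: (hW _ g delta D t x0 D0 DY t0).
  - move=> j; apply: le_lt_trans (hball _ _ (ltnW (ltn_ord j.2))) _; lra.
  - move=> j; apply: (le_trans (metric_triangle _ x0 _)).
    have := hball j.1 _ (ltn_ord j.2); have := hball j.1 _ (ltnW (ltn_ord j.2)).
    by rewrite /g (metric_sym _ x0); lra.
  - move=> i j ij; have ij' : (i.1, val i.2) != (j.1, val j.2).
      apply: contra ij => /eqP[e1 /val_inj e2].
      by rewrite (surjective_pairing i) (surjective_pairing j) e1 e2.
    have iN := ltnW (ltn_ord i.2); have jN := ltnW (ltn_ord j.2).
    apply: hH; first exact: ne.
    exact: cmp (pstep _ _ (ltn_ord i.2)) (psep _ _ _ _ iN jN ij').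
have hge : K%:R * (D / (2 * H)) <= \sum_j delta j.
  rewrite -(pair_bigA _ (fun k l => mdist (f (p k (val l))) (f (p k (val l).+1)))) /=.
  rewrite mulr_natl -[K in _ *+ K]card_ord -sumr_const; apply: ler_sum => k _.
  apply: le_trans (path_triangle (fun l => f (p k l)) N).
  by rewrite ler_pdivrMr ?mulr_gt0// mulrC; exact: long.
have w0 : 0 < 4 * H * N%:R by rewrite mulr_gt0.
have eD : D = t * (4 * H * N%:R).
  by rewrite /t divfK// gt_eqF.
have hK : K%:R * D <= (C1 * (4 * H) * (4 * H) `^ (alpha - 1) * N%:R `^ (alpha - 1)) * D.
  have := le_trans hge hle; rewrite card_prod !card_ord natrM.
  have -> : C1 * D `^ alpha * (t * t `^ (- alpha)) =
      C1 * ((4 * H) `^ (alpha - 1) * N%:R `^ (alpha - 1)) * D.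
    rewrite {1}eD powRM ?(ltW t0) ?(ltW w0)// powRN -(mulr_powRB1 (ltW w0)); last lra.
    rewrite -powRM ?(ltW H4) ?(ltW NR0)// [X in _ = _ * X]eD.
    have := powR_gt0 alpha t0; set a := t `^ alpha; set b := _ `^ _ => a0.
    by field; rewrite gt_eqF.
  have -> : K%:R * N%:R * t = K%:R * D / (4 * H).
    by rewrite eD; field; lra.
  set E := _ * N%:R `^ _ => h.
  have h2 : K%:R * D / (4 * H) <= C1 * E * D by move: h; rewrite /E; lra.
  by move: h2; rewrite ler_pdivrMr// /E; lra.
by apply: (le_trans NK); rewrite -(ler_pM2r D0).
Qed.

(** For alpha < 1 + s the inequality of [ladder_sum] fails for large N, as N ^
    s outgrows N ^ (alpha - 1). *)
Theorem ladder_bound (X Y : metricType R) (f : X -> Y) (s c C alpha : R) :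
  0 < s -> 0 < c -> 0 < C -> (forall N, (0 < N)%N -> ladder X s c C N) ->
  quasisymmetric f -> assouad_bound Y alpha -> 1 + s <= alpha.
Proof.
move=> s0 c0 C0 hl qsf hY; rewrite leNgt; apply/negP => als.
(* The packing argument needs an exponent above 1; increasing alpha preserves
   its Assouad bound. *)
pose al := Num.max alpha (1 + s / 2).
have al1 : 1 < al by rewrite lt_max; apply/orP; right; lra.
have al2 : al < 1 + s by rewrite gt_max als /=; lra.
have hY' : assouad_bound Y al.
  case: hY => C' C'0 h; exists C' => // r rho r0 rrho hd x.
  have [q [h1 h2]] := h r rho r0 rrho hd x; exists q; split => //.
  apply: (le_trans h1); rewrite ler_pM2l// ler_powR ?le_max ?lexx//.
  by rewrite ler_pdivlMr//; lra.
have [C2 C20 h] := ladder_sum s c0 C0 qsf al1 hY'.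
pose e := s - (al - 1); have e0 : 0 < e by rewrite /e; lra.
pose N := (Num.truncn ((C2 + 1) `^ e^-1)).+1.
have NR : (C2 + 1) `^ e^-1 < N%:R by exact: truncnS_gt.
have N0 : 0 < N%:R :> R by rewrite ltr0n.
have C21 : 0 < C2 + 1 by lra.
have h1 : C2 + 1 < N%:R `^ e.
  have := gt0_ltr_powR e0 _ _ NR; rewrite -powRrM mulVf ?gt_eqF// powRr1 ?(ltW C21)//.
  by apply; rewrite nnegrE ?powR_ge0.
have := h N isT (hl N isT).
have -> : N%:R `^ s = N%:R `^ e * N%:R `^ (al - 1) :> R.
  by rewrite -powRD ?(gt_eqF N0) ?implybT// /e; congr powR; ring.
rewrite ler_pM2r ?powR_gt0//; lra.
Qed.

End Ladders.

(** * Powers of ultrametrics and uniform disconnectedness *)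

(** The axioms of the distance are parameters of the type, from which its
    metric structure is inferred. *)
Definition remetrized {R : realType} (T : choiceType) (dist : T -> T -> R)
    (distxx : forall x, dist x x = 0)
    (dist_eq0 : forall x y, dist x y = 0 -> x = y)
    (distC : forall x y, dist x y = dist y x)
    (dist_triangle : forall y x z, dist x z <= dist x y + dist y z) : Type := T.

Section Remetrized.
Context {R : realType} (T : choiceType) (dist : T -> T -> R)
  (distxx : forall x, dist x x = 0)
  (dist_eq0 : forall x y, dist x y = 0 -> x = y)
  (distC : forall x y, dist x y = dist y x)
  (dist_triangle : forall y x z, dist x z <= dist x y + dist y z).

Local Notation Y := (remetrized distxx dist_eq0 distC dist_triangle).

HB.instance Definition _ := Choice.copy Y T.
HB.instance Definition _ :=
  @isMetric.Build R Y dist distxx dist_eq0 distC dist_triangle.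

Lemma mdist_remetrized (x y : Y) : mdist x y = dist x y.
Proof. by []. Qed.

End Remetrized.

Section Snowflake.
Context {R : realType}.

Lemma continuous_mdist (X Y : metricType R) (f : X -> Y) :
  (forall x (e : R), 0 < e -> exists2 del, 0 < del &
     forall y, mdist x y < del -> mdist (f x) (f y) < e) ->
  continuous f.
Proof.
move=> h x; apply/cvg_ballP => e e0; have [del del0 hd] := h x e e0.
apply/nbhs_ballP; exists del => //= y; rewrite !ballEmdist /=; exact: hd.
Qed.

Lemma iter_sqrtK k (t : R) : 0 <= t -> iter k Num.sqrt (t ^+ (2 ^ k)) = t.
Proof.
move=> t0.
elim: k => [|k IH]; first by rewrite expr1.
by rewrite expnSr exprM iterSr sqrtr_sqr ger0_norm ?exprn_ge0.
Qed.

Lemma iter_sqrt_ge0 k (t : R) : 0 <= t -> 0 <= iter k Num.sqrt t.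
Proof. by case: k => //= k _; exact: sqrtr_ge0. Qed.

Lemma sqrt_iterK k (t : R) : 0 <= t -> (iter k Num.sqrt t) ^+ (2 ^ k) = t.
Proof.
move=> t0; elim: k => [|k IH]; first by rewrite expr1.
by rewrite /= expnS exprM sqr_sqrtr ?iter_sqrt_ge0.
Qed.

(** Only exponents that are powers of two occur, so the inverse is an iterated
    square root. *)
Lemma homeomorphism_pow k (C : R) : 0 < C ->
  @homeomorphism_on R R `[0, +oo[ `[0, +oo[ (fun t => (C * t) ^+ (2 ^ k)).
Proof.
move=> C0; exists (fun t => iter k Num.sqrt t / C); split.
- move=> t /=; rewrite !in_itv /= !andbT => t0.
  by rewrite exprn_ge0// mulr_ge0// ltW.
- move=> t /=; rewrite !in_itv /= !andbT => t0.
  by rewrite divr_ge0 ?iter_sqrt_ge0// ltW.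
- move=> t /set_mem /=; rewrite in_itv /= andbT => t0.
  by rewrite iter_sqrtK ?mulr_ge0 ?(ltW C0)// mulrC mulrA mulVf ?mul1r// gt_eqF.
- move=> t /set_mem /=; rewrite in_itv /= andbT => t0.
  by rewrite mulrC divfK ?gt_eqF// sqrt_iterK.
- split; apply: continuous_subspaceT => t.
    apply: (@continuous_comp R R R ( *%R C) (fun u => u ^+ (2 ^ k))).
      exact: mulrl_continuous.
    exact: exprn_continuous.
  apply: (@continuous_comp R R R (iter k Num.sqrt) ( *%R^~ C^-1)).
    elim: k t => [|k IH] t; first exact: cvg_id.
    apply: (@continuous_comp R R R (iter k Num.sqrt) Num.sqrt); first exact: IH.
    exact: sqrt_continuous.
  exact: mulrr_continuous.
Qed.

Lemma quasisymmetric_id (X : metricType R) : quasisymmetric (@idfun X).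
Proof.
split.
  by exists idfun; split=> //; split; apply: continuous_subspaceT => x; exact: cvg_id.
exists (fun t => (1 * t) ^+ (2 ^ 0)); first exact: homeomorphism_pow.
by move=> x a b xb; rewrite /= mul1r expn0 expr1.
Qed.

Definition coverable (X : metricType R) (P : set X) (r B : R) : Prop :=
  exists s : seq X, (size s)%:R <= B /\ P `<=` \bigcup_(y in [set` s]) ball y r.

Lemma coverable_bigcup (X : metricType R) (T : eqType) (s : seq T)
    (Q : set X) (P : T -> set X) (r M B : R) :
  0 <= B -> (size s)%:R <= M ->
  Q `<=` \bigcup_(t in [set` s]) P t ->
  (forall t, t \in s -> coverable (P t) r B) -> coverable Q r (M * B).
Proof.
move=> B0 sM QP hP.
have [q [q1 q2]] : coverable (\bigcup_(t in [set` s]) P t) r ((size s)%:R * B).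
  elim: s hP {sM QP} => [|t s IH] hP.
    by exists [::]; rewrite mul0r; split => // y [].
  have [q [q1 q2]] := IH (fun u us => hP u (mem_behead (s := t :: s) us)).
  have [q' [q'1 q'2]] := hP t (mem_head _ _).
  exists (q' ++ q); rewrite size_cat natrD /= -nat1r mulrDl mul1r; split.
    exact: lerD.
  move=> y [u /=]; rewrite inE => /predU1P[->|us] yu.
    by have [z zq yz] := q'2 y yu; exists z => //=; rewrite mem_cat zq.
  have [|z zq yz] := q2 y; first by exists u.
  by exists z => //=; rewrite mem_cat zq orbT.
exists q; split; last exact: subset_trans q2.
by apply: (le_trans q1); rewrite ler_wpM2r.
Qed.

(** The condition of the Assouad bound at all scales, without reference to the
    diameter. In this form it passes to powers of the metric, which change the
    two scales and the diameter differently. *)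
Definition doubling_bound (X : metricType R) (alpha : R) : Prop :=
  exists2 C : R, 0 < C & forall (r rho : R), 0 < r -> r <= rho -> forall x : X,
    coverable (ball x rho) r (C * (rho / r) `^ alpha).

Lemma assouad_boundW (X : metricType R) (alpha : R) :
  doubling_bound X alpha -> assouad_bound X alpha.
Proof.
move=> [C C0 h]; exists C => // r rho r0 rrho _ x; apply: h => //; lra.
Qed.

Section Ultrametric.
Context (X : metricType R) (rho : X -> X -> R) (C : R).
Context (C1 : 1 <= C) (rho_ge0 : forall x y, 0 <= rho x y)
  (rho_le : forall x y, rho x y <= mdist x y)
  (le_rho : forall x y, mdist x y <= C * rho x y)
  (rhoC : forall x y, rho x y = rho y x)
  (rho_max : forall y x z, rho x z <= Num.max (rho x y) (rho y z)).

Let snow k x y := rho x y ^+ (2 ^ k).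

Let rhoxx x : rho x x = 0.
Proof. by apply/eqP; rewrite eq_le rho_ge0 andbT -(mdistxx x) rho_le. Qed.

Let k2 k : (2 ^ k)%N != 0%N.
Proof. by rewrite expn_eq0. Qed.

Let snowxx k x : snow k x x = 0.
Proof. by rewrite /snow rhoxx expr0n (negbTE (k2 k)). Qed.

Let snow_eq0 k x y : snow k x y = 0 -> x = y.
Proof.
move=> /eqP; rewrite expf_eq0 => /andP[_ /eqP h].
apply: mdist_positivity; apply/eqP.
by rewrite eq_le mdist_ge0 andbT (le_trans (le_rho _ _))// h mulr0.
Qed.

Let snowC k x y : snow k x y = snow k y x.
Proof. by rewrite /snow rhoC. Qed.

Let snow_triangle k y x z : snow k x z <= snow k x y + snow k y z.
Proof.
have := rho_max y x z; rewrite le_max => /orP[] h.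
  apply: (@le_trans _ _ (snow k x y)); last by rewrite lerDl exprn_ge0.
  by rewrite /snow lerXn2r ?nnegrE.
apply: (@le_trans _ _ (snow k y z)); last by rewrite lerDr exprn_ge0.
by rewrite /snow lerXn2r ?nnegrE.
Qed.

Let Y k : metricType R :=
  remetrized (snowxx k) (@snow_eq0 k) (snowC k) (@snow_triangle k).

Let quasisymmetric_snow k : @quasisymmetric R X (Y k) idfun.
Proof.
have C0 : 0 < C by exact: lt_le_trans C1.
split.
  exists idfun; split => //; split; apply: continuous_subspaceT; apply: continuous_mdist => x e e0.
    exists (Num.min 1 e) => [|y]; first by rewrite lt_min ltr01.
    rewrite lt_min => /andP[y1 ye]; rewrite mdist_remetrized.
    apply: le_lt_trans ye; apply: (@le_trans _ _ (mdist x y ^+ (2 ^ k))).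
      by rewrite /snow lerXn2r ?nnegrE ?mdist_ge0.
    by rewrite ler_iXnr ?mdist_ge0 ?(ltW y1)// expn_gt0.
  exists ((e / C) ^+ (2 ^ k)) => [|y]; first by rewrite exprn_gt0// divr_gt0.
  rewrite mdist_remetrized => h; apply: le_lt_trans (le_rho _ _) _.
  rewrite mulrC -ltr_pdivlMr//.
  by move: h; rewrite /snow ltr_pXn2r ?expn_gt0 ?nnegrE ?divr_ge0 ?(ltW e0) ?(ltW C0).
exists (fun t => (C * t) ^+ (2 ^ k)); first exact: homeomorphism_pow.
move=> x a b xb; rewrite !mdist_remetrized /snow /=.
have xb0 : 0 < mdist x b by rewrite mdist_gt0; apply/eqP.
have rxb : 0 < rho x b by rewrite -(pmulr_rgt0 _ C0) (lt_le_trans xb0).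
have h : rho x a / rho x b <= C * (mdist x a / mdist x b).
  rewrite ler_pdivrMr// (le_trans (rho_le _ _))//.
  have -> : C * (mdist x a / mdist x b) * rho x b = mdist x a * (C * rho x b) / mdist x b by ring.
  by rewrite ler_pdivlMr// ler_wpM2l ?mdist_ge0.
by rewrite -expr_div_n lerXn2r ?nnegrE ?mulr_ge0 ?invr_ge0 ?mdist_ge0 ?(ltW C0).
Qed.

Let assouad_snow k alpha : doubling_bound X alpha ->
  assouad_bound (Y k) (alpha / (2 ^ k)%:R).
Proof.
move=> [C' C'0 h].
have C0 : 0 < C by exact: lt_le_trans C1.
exists (C' * C `^ alpha); first by rewrite mulr_gt0// powR_gt0.
move=> r s r0 rs _ x; have s0 : 0 < s by lra.
pose r' := iter k Num.sqrt r; pose s' := iter k Num.sqrt s.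
have r'E : r' ^+ (2 ^ k) = r by rewrite sqrt_iterK// ltW.
have s'E : s' ^+ (2 ^ k) = s by rewrite sqrt_iterK// ltW.
have r'ge : 0 <= r' by rewrite iter_sqrt_ge0// ltW.
have s'ge : 0 <= s' by rewrite iter_sqrt_ge0// ltW.
have r'0 : 0 < r'.
  rewrite lt_def r'ge andbT; apply: contraTneq r0 => e.
  by rewrite -r'E e expr0n (negbTE (k2 k)) ltxx.
have rs' : r' <= s' by rewrite -(ler_pXn2r (n := 2 ^ k)) ?expn_gt0 ?nnegrE// r'E s'E; lra.
have [|q [hq1 hq2]] := h r' (C * s') r'0 _ (x : X).
  by apply: (le_trans rs'); rewrite ler_peMl.
exists q; split.
  apply: (le_trans hq1); rewrite -[leRHS]mulrA ler_pM2l// -[C * s' / r']mulrA.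
  rewrite powRM ?(ltW C0) ?divr_ge0//.
  rewrite ler_pM2l ?powR_gt0//.
  have -> : s / r = (s' / r') ^+ (2 ^ k) by rewrite expr_div_n r'E s'E.
  rewrite -[X in _ <= X `^ _]powR_mulrn ?divr_ge0// -powRrM mulrCA mulfV ?mulr1 ?lexx//.
move=> y; rewrite ballEmdist /= mdist_remetrized => hy.
have /hq2[z zq] : @ball R X x (C * s') y.
  rewrite ballEmdist /=; apply: le_lt_trans (le_rho _ _) _; rewrite ltr_pM2l//.
  by rewrite -(ltr_pXn2r (n := 2 ^ k)) ?expn_gt0 ?nnegrE// s'E.
rewrite ballEmdist /= => hz; exists z => //; rewrite ballEmdist /= mdist_remetrized.
by rewrite -r'E ltr_pXn2r ?expn_gt0 ?nnegrE//; apply: le_lt_trans hz.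
Qed.

(** Every power of an ultrametric is a metric, because its triangle inequality
    follows from the one with a maximum. Raising to the power 2 ^ k is
    quasi-symmetric and divides the exponent of the covering bound by 2 ^ k,
    so the dimension can be made arbitrarily small. *)
Lemma conformal_dim_ultrametric alpha : 0 < alpha -> doubling_bound X alpha ->
  conformal_assouad_dim X = 0%E.
Proof.
move=> alpha0 hX; apply/eqP; rewrite eq_le; apply/andP; split; last first.
  apply: le_ereal_inf_tmp => _ [Y' [f [_ ->]]].
  by apply: le_ereal_inf_tmp => _ [al [al0 _] <-]; rewrite lee_fin ltW.
apply/lee_addgt0Pr => e e0; rewrite add0e.
have [k hk] : exists k, alpha / (2 ^ k)%:R <= e.
  pose n := (Num.truncn (alpha / e)).+1; exists n.
  have : alpha / e < n%:R by exact: truncnS_gt.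
  rewrite ltr_pdivrMr// => h.
  rewrite ler_pdivrMr ?ltr0n ?expn_gt0// (le_trans (ltW h))// mulrC ler_pM2l//.
  by rewrite ler_nat ltnW// ltn_expl.
apply: (@ge_ereal_inf _ _ _); exists (assouad_dim (Y k)).
  by exists (Y k), idfun; split => //; exact: quasisymmetric_snow.
apply: ge_ereal_inf; exists (alpha / (2 ^ k)%:R)%:E; last by rewrite lee_fin.
exists (alpha / (2 ^ k)%:R) => //; split; first by rewrite divr_gt0 ?ltr0n ?expn_gt0.
exact: assouad_snow.
Qed.

End Ultrametric.
End Snowflake.

Section Chains.
Context {R : realType} (X : metricType R).

Definition chain (e : R) (x y : X) : Prop :=
  exists2 s : seq X, path (fun u v => mdist u v <= e) x s & last x s = y.

Lemma chain_le e e' x y : e <= e' -> chain e x y -> chain e' x y.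
Proof.
move=> ee [s xs <-]; exists s => //.
by apply: sub_path xs => u v /le_trans; apply.
Qed.

Lemma chain_trans e y x z : chain e x y -> chain e y z -> chain e x z.
Proof.
move=> [s xs <-] [s' ys' <-]; exists (s ++ s'); first by rewrite cat_path xs.
by rewrite last_cat.
Qed.

Lemma chain_sym e x y : chain e x y -> chain e y x.
Proof.
move=> [s]; elim: s x => [|z s IH] x /=; first by move=> _ <-; exists [::].
move=> /andP[xz zs] zy; apply: (chain_trans (IH _ zs zy)).
by exists [:: x] => //=; rewrite metric_sym xz.
Qed.

Lemma path_jump (pr : X -> R) (e p q : R) (x : X) (s : seq X) :
  (forall u v, `|pr u - pr v| <= mdist u v) -> 0 <= e ->
  path (fun u v => mdist u v <= e) x s ->
  (forall z, z \in x :: s -> ~ (p < pr z < q)) ->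
  pr x <= p -> q <= pr (last x s) -> q - p <= e.
Proof.
move=> hpr e0; elim: s x => [|z s IH] x /=; first by move=> _ _; lra.
move=> /andP[xz zs] hav xp qe.
have [zp|pz] := lerP (pr z) p.
  by apply: (IH z) => // z' z's; apply: hav; rewrite inE z's orbT.
have qz : q <= pr z.
  rewrite leNgt; apply/negP => zq; apply: (hav z); last by rewrite pz.
  by rewrite !inE eqxx orbT.
have := le_trans (hpr x z) xz; rewrite distrC => /(le_trans (ler_norm _)); lra.
Qed.

Lemma chain_mem (e : R) (x z : X) s :
  path (fun u v => mdist u v <= e) x s -> z \in x :: s -> chain e x z.
Proof.
rewrite inE => xs /predU1P[->|zs]; first by exists [::].
case/splitPr: zs xs => s1 s2; rewrite -cat_rcons cat_path => /andP[h _].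
by exists (rcons s1 z) => //; rewrite last_rcons.
Qed.

(** The largest ultrametric below the given metric. *)
Definition chain_dist (x y : X) : R := inf [set e | 0 <= e /\ chain e x y].

Let chain_mdist x y : 0 <= mdist x y /\ chain (mdist x y) x y.
Proof. by split; [exact: mdist_ge0|exists [:: y] => //=; rewrite lexx]. Qed.

Let lb x y : has_lbound [set e | 0 <= e /\ chain e x y].
Proof. by exists 0 => e /= []. Qed.

Let chain_dist_ge0 x y : 0 <= chain_dist x y.
Proof. by apply: lb_le_inf; [exists (mdist x y); exact: chain_mdist|move=> e []]. Qed.

Let chain_dist_le x y : chain_dist x y <= mdist x y.
Proof. by apply: ge_inf; [exact: lb|exact: chain_mdist]. Qed.

Let chain_distC x y : chain_dist x y = chain_dist y x.
Proof.
by congr inf; apply/seteqP; split => e /= [e0 /chain_sym].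
Qed.

Let chain_dist_max y x z :
  chain_dist x z <= Num.max (chain_dist x y) (chain_dist y z).
Proof.
rewrite leNgt gt_max; apply/negP => /andP[h1 h2].
have [|e1 /= [e10 c1] e1l] := inf_lt _ h1; first by exists (mdist x y); exact: chain_mdist.
have [|e2 /= [e20 c2] e2l] := inf_lt _ h2; first by exists (mdist y z); exact: chain_mdist.
have : chain_dist x z <= Num.max e1 e2.
  apply: ge_inf; first exact: lb.
  split; first by rewrite le_max e10.
  apply: (@chain_trans _ y); [apply: chain_le c1|apply: chain_le c2].
    by rewrite le_max lexx.
  by rewrite le_max lexx orbT.
by rewrite leNgt gt_max e1l e2l.
Qed.

Definition uniformly_disconnected (C : R) : Prop :=
  forall e x y, 0 <= e -> chain e x y -> mdist x y <= C * e.

(** Uniform disconnectedness says that the chain distance, an ultrametric by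
    construction, is comparable to the metric. *)
Lemma conformal_dim_uniformly_disconnected C alpha : 0 < C ->
  uniformly_disconnected C -> 0 < alpha -> doubling_bound X alpha ->
  conformal_assouad_dim X = 0%E.
Proof.
move=> C0 hC alpha0 hX.
apply: (@conformal_dim_ultrametric _ X chain_dist (Num.max 1 C) _ _ _ _ _ _ alpha) => //.
  by rewrite le_max lexx.
move=> x y; apply: (@le_trans _ _ (C * chain_dist x y)); last first.
  by rewrite ler_wpM2r// le_max lexx orbT.
rewrite mulrC -ler_pdivrMr//; apply: lb_le_inf; first by exists (mdist x y); exact: chain_mdist.
by move=> e [e0 /(hC _ _ _ e0) h]; rewrite ler_pdivrMr// mulrC.
Qed.

End Chains.

(** * Preliminaries on finite families and on the plane *)

Section Finite.
Context {R : realType}.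

Lemma finite_min (I : finType) (f : I -> R) : (forall i, 0 < f i) ->
  exists2 x, 0 < x & forall i, x <= f i.
Proof.
move=> f0; have [i0 _|I0] := pickP (@predT I).
  have [i _ hi] := @Order.TotalTheory.arg_minP _ _ I i0 xpredT f isT.
  by exists (f i) => // j; exact: hi.
by exists 1 => // i; have := I0 i.
Qed.

Lemma finite_max (I : finType) (f : I -> R) : (forall i, f i < 1) ->
  exists2 x, x < 1 & forall i, f i <= x.
Proof.
move=> f1; have [|x x0 hx] := @finite_min I (fun i => 1 - f i).
  by move=> i; rewrite subr_gt0.
by exists (1 - x) => [|i]; [lra|have := hx i; lra].
Qed.

Lemma expr_small (x e : R) : 0 <= x -> x < 1 -> 0 < e -> exists k, x ^+ k <= e.
Proof.
move=> x0 x1 e0; have : `|x| < 1 by rewrite ger0_norm.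
move=> /cvg_expr/cvgrPdist_lt/(_ e e0)[k _ /(_ k (leqnn k))].
by rewrite /= sub0r normrN ger0_norm ?exprn_ge0// => /ltW; exists k.
Qed.

Lemma ordered_enum (k : nat) (T : eqType) (f : 'I_k -> T) (r t : T -> R) :
  (forall i, 0 <= t (f i)) ->
  (forall i i' : 'I_k, i' = i.+1 :> nat -> t (f i) + r (f i) <= t (f i')) ->
  (forall i : 'I_k, i.+1 = k -> t (f i) + r (f i) <= 1) ->
  ordered r t 0 [seq f i | i <- enum 'I_k] 1.
Proof.
move=> t0 hgap hlast.
suff H e : forall j x, (k - j = e)%N -> (j <= k)%N ->
    (forall i : 'I_k, i = j :> nat -> x <= t (f i)) -> (j = k -> x <= 1) ->
    ordered r t x (drop j [seq f i | i <- enum 'I_k]) 1.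
  rewrite -[X in ordered _ _ _ X](drop0 (map f (enum 'I_k))).
  apply: (H k) => //; rewrite ?subn0//.
elim: e => [|e IH] j x kj jk hx h1.
  have {}jk : j = k by lia.
  rewrite drop_oversize; last by rewrite size_map size_enum_ord jk.
  exact: h1.
have jlt : (j < k)%N by lia.
rewrite (drop_nth (f (Ordinal jlt))); last by rewrite size_map size_enum_ord.
rewrite (nth_map (Ordinal jlt)); last by rewrite size_enum_ord.
have -> : nth (Ordinal jlt) (enum 'I_k) j = Ordinal jlt.
  by apply: val_inj; rewrite /= nth_enum_ord.
split; first exact: hx.
apply: IH; [lia|lia| |].
  by move=> i ij; apply: hgap; rewrite ij.
by move=> jk'; apply: hlast.
Qed.

End Finite.

Section Plane.
Context {R : realType}.
Implicit Types p q : plane R.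

Lemma mdist_plane p q : mdist p q = Num.sqrt ((p.1 - q.1) ^+ 2 + (p.2 - q.2) ^+ 2).
Proof. by []. Qed.

Lemma mdist_ge_fst p q : `|p.1 - q.1| <= mdist p q.
Proof. by rewrite mdist_plane -sqrtr_sqr ler_wsqrtr// lerDl sqr_ge0. Qed.

Lemma mdist_ge_snd p q : `|p.2 - q.2| <= mdist p q.
Proof. by rewrite mdist_plane -sqrtr_sqr ler_wsqrtr// lerDr sqr_ge0. Qed.

Lemma mdist_leD p q : mdist p q <= `|p.1 - q.1| + `|p.2 - q.2|.
Proof.
rewrite mdist_plane -[leRHS]ger0_norm ?addr_ge0// -[leRHS]sqrtr_sqr ler_wsqrtr//.
rewrite [leRHS]sqrrD !real_normK ?num_real// -addrA lerD2l lerDr.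
by rewrite mulrn_wge0// mulr_ge0.
Qed.

Lemma compact_lipschitz_bounded (X : metricType R) (S : set X) (pr : X -> R) :
  compact S -> (forall x y, `|pr x - pr y| <= mdist x y) ->
  exists2 B, 0 <= B & forall x, S x -> `|pr x| <= B.
Proof.
move=> cS hpr; have cpr : continuous pr.
  move=> p; apply/cvgrPdist_lt => e e0; apply/nbhs_ballP; exists e => //= q.
  by rewrite ballEmdist /=; exact: le_lt_trans (hpr _ _).
have : compact (pr @` S) by apply: continuous_compact => //; exact: continuous_subspaceT.
move=> /compact_bounded[M [_ hM]]; exists (Num.max 0 (M + 1)); first by rewrite le_max lexx.
move=> p Sp; apply: (hM (Num.max 0 (M + 1))); last by exists p.
by rewrite lt_max ltrDl ltr01 orbT.
Qed.

Lemma compact_plane_bounded (S : set (plane R)) : compact S ->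
  exists2 B, 0 <= B & forall p, S p -> `|p.1| <= B /\ `|p.2| <= B.
Proof.
move=> cS.
have [B1 B10 h1] := compact_lipschitz_bounded cS mdist_ge_fst.
have [B2 B20 h2] := compact_lipschitz_bounded cS mdist_ge_snd.
exists (B1 + B2) => [|p Sp]; first exact: addr_ge0.
by have := h1 p Sp; have := h2 p Sp; split; lra.
Qed.

End Plane.

(** * Ladders made of strips *)

Section Strips.
Context {R : realType} (S : set (plane R)).
Local Notation X := (set_type S : metricType R).

Definition plane_pt (x : X) : plane R := set_val x.
Local Notation pos := plane_pt.

Lemma mdist_subset (x y : X) : mdist x y = mdist (pos x) (pos y).
Proof. by []. Qed.

Lemma plane_ptP (x : X) : S (pos x).
Proof. by rewrite /plane_pt set_valE; exact: set_mem (valP x). Qed.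

Lemma plane_pt_surj p : S p -> exists x : X, pos x = p.
Proof. by move=> /mem_set h; exists (SigSub h); rewrite /plane_pt set_valE. Qed.

(** The common form of the vertical and the horizontal ladders: lin is the
    coordinate along the paths and tr the one across them. Each stopping word
    v of length about 1 / N determines a strip across an approximate square
    with sides s and s', and the word sfx keeps different strips apart.
    Positions along a strip are prescribed up to a quarter of the step s' / N,
    which makes consecutive points close and distinct points separated. *)
Lemma ladder_strips (lin tr : plane R -> R) (L : eqType) (rho tau : L -> R)
    (lo hi : R) (As : seq (seq L)) (sfx : seq L) (sdim s s' x0 y0 : R) (N : nat) :
  0 < lo -> lo <= 1 ->
  (forall p q, `|lin p - lin q| <= mdist p q) ->
  (forall p q, `|tr p - tr q| <= mdist p q) ->
  (forall p q, mdist p q <= `|lin p - lin q| + `|tr p - tr q|) ->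
  alphabets rho tau lo hi As -> 0 <= sdim ->
  (forall A, A \in As -> \sum_(l <- A) rho l `^ sdim = 1) ->
  (0 < N)%N -> (forall w : seq L, fits w As -> wratio rho w <= N%:R^-1) ->
  0 < wratio rho sfx -> lo ^+ 2 <= wshift rho tau sfx ->
  wshift rho tau sfx + wratio rho sfx <= 1 - lo ^+ 2 ->
  0 < s -> 0 < s' -> lo * s' <= s -> lo * s <= s' ->
  (forall (v : seq L) (l : nat), v \in stopping rho As N%:R^-1 -> (l <= N)%N -> exists2 p, S p &
     `|lin p - (x0 + l%:R * (s' / N%:R))| <= s' / N%:R / 4 /\
     y0 + s * wshift rho tau (v ++ sfx) <= tr p <=
       y0 + s * (wshift rho tau (v ++ sfx) + wratio rho (v ++ sfx))) ->
  ladder X sdim (lo ^+ 4 / 2) (lo^-1 + 2) N.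
Proof.
move=> lo0 lo1 lin1 tr1 lintr hAs sdim0 hsum N0 hN sf0 sf1 sf2 s0 s'0 ss' s's hp.
have NR : 0 < N%:R :> R by rewrite ltr0n.
pose t : R := N%:R^-1; have t0 : 0 < t by rewrite invr_gt0.
have t1 : t <= 1 by rewrite invf_le1// ler1n.
pose V := stopping rho As t; pose r := s' / N%:R.
have r0 : 0 < r by rewrite divr_gt0.
have /choice[p hpP] (kl : 'I_(size V) * nat) : exists x : X, (kl.2 <= N)%N ->
    `|lin (pos x) - (x0 + kl.2%:R * r)| <= r / 4 /\
     y0 + s * wshift rho tau (tnth (in_tuple V) kl.1 ++ sfx) <= tr (pos x) <=
     y0 + s * (wshift rho tau (tnth (in_tuple V) kl.1 ++ sfx) +
               wratio rho (tnth (in_tuple V) kl.1 ++ sfx)).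
  have vV := mem_tnth kl.1 (in_tuple V); have [lN|lN] := leqP kl.2 N; last first.
    have [q Sq _] := hp _ 0 vV (leq0n _); have [x _] := plane_pt_surj Sq.
    by exists x.
  have [q Sq [q1 q2]] := hp _ _ vV lN; have [x xq] := plane_pt_surj Sq.
  by exists x => _; rewrite xq.
exists (size V), r, (fun k (l : nat) => p (k, l)).
have hlin k (l : nat) : (l <= N)%N -> `|lin (pos (p (k, l))) - (x0 + l%:R * r)| <= r / 4.
  by move=> lN; have [] := hpP (k, l) lN.
have strip (v : seq L) : v \in V -> [/\ lo * t <= wratio rho v, wratio rho v <= t,
    0 <= wshift rho tau v & wshift rho tau v + wratio rho v <= 1].
  move=> vV.
  have [h3 h4] := wshift_range lo0 (alphabets_take (k:=_) hAs) (stopping_fits vV).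
  by split => //; [exact: (stopping_lo lo0 hAs lo1 t0 t1 vV)|exact: (stopping_hi lo0 hAs hN vV)].
have sN : s * t <= lo^-1 * r.
  rewrite /r /t mulrA ler_pM2r ?invr_gt0// mulrC ler_pdivlMr// mulrC.
  exact: s's.
have lor : 0 < lo^-1 * r by rewrite mulr_gt0 ?invr_gt0.
(* The strip of v stays inside the cylinder of v, at a distance proportional
   to its length from both ends. *)
have htr k (l : nat) : (l <= N)%N -> let v := tnth (in_tuple V) k in
    y0 + s * (wshift rho tau v + wratio rho v * lo ^+ 2) <= tr (pos (p (k, l))) <=
    y0 + s * (wshift rho tau v + wratio rho v * (1 - lo ^+ 2)).
  move=> lN /=; set v := tnth _ _; have [_ /andP[h1 h2]] := hpP (k, l) lN.
  have [v1 v2 v3 v4] := strip v (mem_tnth k (in_tuple V)).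
  have v0 : 0 < wratio rho v by apply: lt_le_trans v1; rewrite mulr_gt0.
  move: h1 h2; rewrite /= -/v wshift_cat wratio_cat => h1 h2; apply/andP; split.
    apply: le_trans h1; rewrite lerD2l ler_pM2l// lerD2l ler_pM2l//.
  apply: (le_trans h2); rewrite lerD2l ler_pM2l// -addrA -mulrDr lerD2l ler_pM2l//.
have lo4 : lo ^+ 4 / 2 * r <= r / 2.
  have h : lo ^+ 4 <= 1 by rewrite exprn_ile1// ltW.
  by have : lo ^+ 4 * r <= r by [rewrite ler_piMl// ltW]; lra.
have same k (l l' : nat) : (l <= N)%N -> (l' <= N)%N ->
    `|tr (pos (p (k, l))) - tr (pos (p (k, l')))| <= lo^-1 * r.
  move=> lN l'N; have /= /andP[h1 h2] := htr k l lN; have /= /andP[h3 h4] := htr k l' l'N.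
  have [v1 v2 v3 v4] := strip _ (mem_tnth k (in_tuple V)).
  set v := tnth _ _ in h1 h2 h3 h4 v1 v2 v3 v4.
  have e1 : s * (wratio rho v * (1 - lo ^+ 2)) - s * (wratio rho v * lo ^+ 2) <= s * t.
    rewrite -mulrBr ler_pM2l// -mulrBr.
    have : 0 <= wratio rho v by apply: le_trans v1; rewrite mulr_ge0 ?ltW.
    have := sqr_ge0 lo; nra.
  by rewrite ler_norml; apply/andP; split; lra.
have Nr : N%:R * r = s' by rewrite /r mulrC divfK// gt_eqF.
split => //.
- have -> : N%:R = t^-1 :> R by rewrite invrK.
  exact: (size_stopping_ge lo0 hAs).
- move=> k k' l l' lN l'N; rewrite xpair_eqE negb_and mdist_subset.
  have [<-|kk' _] := eqVneq k k'.
    move=> /= ll'; apply: le_trans (lin1 _ _); apply: (le_trans lo4).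
    have := hlin k l lN; have := hlin k l' l'N.
    rewrite !ler_norml => /andP[h1 h2] /andP[h3 h4].
    move: ll'; rewrite neq_ltn => /orP[] ltl.
      have : l%:R * r + r <= l'%:R * r.
        by rewrite -[X in _ + X]mul1r -mulrDl ler_pM2r// natr1 ler_nat.
      by rewrite distrC => h; apply: le_trans (ler_norm _); lra.
    have : l'%:R * r + r <= l%:R * r.
      by rewrite -[X in _ + X]mul1r -mulrDl ler_pM2r// natr1 ler_nat.
    by move=> h; apply: le_trans (ler_norm _); lra.
  apply: le_trans (tr1 _ _).
  have /= /andP[h1 h2] := htr k l lN; have /= /andP[h3 h4] := htr k' l' l'N.
  have vV := mem_tnth k (in_tuple V); have v'V := mem_tnth k' (in_tuple V).
  have [v1 _ _ _] := strip _ vV; have [v'1 _ _ _] := strip _ v'V.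
  have ne : tnth (in_tuple V) k <> tnth (in_tuple V) k'.
    move=> /(congr1 (index^~ V)); rewrite !(tnth_nth [::]) /=.
    rewrite !index_uniq ?(stopping_uniq lo0 _ hAs)// => /val_inj e.
    by rewrite e eqxx in kk'.
  have sep := stopping_sep lo0 hAs vV v'V ne.
  set v := tnth _ k in h1 h2 v1 sep; set v' := tnth _ k' in h3 h4 v'1 sep.
  have q1 : s * (lo ^+ 2 * (lo * t)) <= s * (lo ^+ 2 * wratio rho v).
    by rewrite ler_pM2l// ler_pM2l// exprn_gt0.
  have q2 : s * (lo ^+ 2 * (lo * t)) <= s * (lo ^+ 2 * wratio rho v').
    by rewrite ler_pM2l// ler_pM2l// exprn_gt0.
  have q3 : lo ^+ 4 * r <= s * (lo ^+ 2 * (lo * t)).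
    have -> : s * (lo ^+ 2 * (lo * t)) = lo ^+ 3 * t * s by ring.
    have -> : lo ^+ 4 * r = lo ^+ 3 * t * (lo * s') by rewrite /r /t; ring.
    by rewrite ler_pM2l// mulr_gt0// exprn_gt0.
  have q4 : 0 < lo ^+ 4 * r by rewrite mulr_gt0// exprn_gt0.
  case: sep => sep.
    have : s * (wshift rho tau v + wratio rho v) <= s * wshift rho tau v' by rewrite ler_pM2l.
    by move=> h; rewrite distrC; apply: le_trans (ler_norm _); lra.
  have : s * (wshift rho tau v' + wratio rho v') <= s * wshift rho tau v by rewrite ler_pM2l.
  by move=> h; apply: le_trans (ler_norm _); lra.
- move=> k l lN; rewrite mdist_subset; apply: le_trans (lintr _ _) _.
  have h5 := same k l l.+1 (ltnW lN) lN.
  have := hlin k l (ltnW lN); have := hlin k _ lN; rewrite -natr1 mulrDl mul1r.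
  rewrite !ler_norml => /andP[h1 h2] /andP[h3 h4].
  have : `|lin (pos (p (k, l))) - lin (pos (p (k, l.+1)))| <= 2 * r.
    by rewrite ler_norml; apply/andP; split; lra.
  lra.
split.
- move=> k; rewrite mdist_subset; apply: le_trans (lin1 _ _).
  have := hlin k 0 (leq0n _); have := hlin k N (leqnn _).
  rewrite mul0r addr0 Nr !ler_norml => /andP[h1 h2] /andP[h3 h4].
  have q1 : lo ^+ 4 / 2 * s' <= s' / 2.
    have : lo ^+ 4 <= 1 by rewrite exprn_ile1// ltW.
    by move=> h; have : lo ^+ 4 * s' <= s' by [rewrite ler_piMl// ltW]; lra.
  have q2 : r <= s' by rewrite /r ler_pdivrMr// ler_peMr ?ler1n// ltW.
  rewrite distrC; apply: le_trans (ler_norm _); lra.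
- move=> k k' l l' lN l'N; rewrite mdist_subset; apply: le_trans (lintr _ _) _.
  have := hlin k l lN; have := hlin k' l' l'N.
  have q2 : r <= s' by rewrite /r ler_pdivrMr// ler_peMr ?ler1n// ltW.
  have lr : l%:R * r <= s' by rewrite -Nr ler_pM2r// ler_nat.
  have l'r : l'%:R * r <= s' by rewrite -Nr ler_pM2r// ler_nat.
  have lr0 : 0 <= l%:R * r by rewrite mulr_ge0// ltW.
  have l'r0 : 0 <= l'%:R * r by rewrite mulr_ge0// ltW.
  have /= /andP[h1 h2] := htr k l lN; have /= /andP[h3 h4] := htr k' l' l'N.
  have [v1 v2 v3 v4] := strip _ (mem_tnth k (in_tuple V)).
  have [v'1 v'2 v'3 v'4] := strip _ (mem_tnth k' (in_tuple V)).
  set v := tnth _ k in h1 h2 v1 v2 v3 v4; set v' := tnth _ k' in h3 h4 v'1 v'2 v'3 v'4.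
  have ss : s <= lo^-1 * s' by rewrite mulrC ler_pdivlMr// mulrC.
  have lo2 := sqr_ge0 lo.
  have lt0 : 0 < lo * t by rewrite mulr_gt0.
  have bd (x y : R) : 0 <= x -> 0 < y -> x + y <= 1 ->
      0 <= s * (x + y * lo ^+ 2) /\ s * (x + y * (1 - lo ^+ 2)) <= s.
    move=> x0' y0' xy; split; first by rewrite mulr_ge0 ?addr_ge0 ?mulr_ge0// ltW.
    by rewrite ler_piMr ?(ltW s0)//; nra.
  have [b1 b2] := bd _ _ v3 (lt_le_trans lt0 v1) v4.
  have [b3 b4] := bd _ _ v'3 (lt_le_trans lt0 v'1) v'4.
  have h5 : `|tr (pos (p (k, l))) - tr (pos (p (k', l')))| <= s.
    by rewrite ler_norml; apply/andP; split; lra.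
  rewrite Nr !ler_norml => /andP[g1 g2] /andP[g3 g4].
  have : `|lin (pos (p (k, l))) - lin (pos (p (k', l')))| <= 2 * s'.
    by rewrite ler_norml; apply/andP; split; lra.
  lra.
Qed.

End Strips.

(** * The carpet and its addresses *)

Section Carpet.
Context {R : realType} (m : nat) (n : 'I_m -> nat)
  (a c : forall i : 'I_m, 'I_(n i) -> R) (b d : 'I_m -> R) (S : set (plane R)).

Definition letter : finType := {i : 'I_m & 'I_(n i)}.
Implicit Types (l : letter) (W V : seq letter) (w v : seq 'I_m).

Definition letter_of (i : 'I_m) (j : 'I_(n i)) : letter :=
  Tagged (fun i => 'I_(n i)) j.

Definition xratio l : R := a (tagged l).
Definition xshift l : R := c (tagged l).
Definition rows : seq 'I_m := [seq i | i <- enum 'I_m].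
(** The alphabet of the horizontal direction at a position where row i was
    chosen. *)
Definition cols (i : 'I_m) : seq letter :=
  [seq letter_of j | j <- enum 'I_(n i)].
Definition row_of W : seq 'I_m := map tag W.

Definition word_map W (p : plane R) : plane R :=
  (wratio xratio W * p.1 + wshift xratio xshift W,
   wratio b (row_of W) * p.2 + wshift b d (row_of W)).

Lemma mem_cols i l : (l \in cols i) = (tag l == i).
Proof.
apply/mapP/eqP => [[j _ ->]//|<-].
by exists (tagged l); rewrite ?mem_enum//; case: l.
Qed.

Lemma sum_rows (F : 'I_m -> R) : \sum_(i <- rows) F i = \sum_i F i.
Proof. by rewrite big_map big_enum. Qed.

Lemma sum_cols i (F : letter -> R) :
  \sum_(l <- cols i) F l = \sum_(j < n i) F (letter_of j).
Proof. by rewrite big_map big_enum. Qed.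

Lemma fits_rows w : fits w (nseq (size w) rows).
Proof. by elim: w => //= i w ->; rewrite andbT /rows map_id mem_enum. Qed.

Lemma fits_cols W w : fits W (map cols w) = (row_of W == w).
Proof.
elim: W w => [|l W IH] [|i w]//=; rewrite eqseq_cons -IH /fits /=.
by rewrite mem_cols.
Qed.

Lemma row_of_cat V W : row_of (V ++ W) = row_of V ++ row_of W.
Proof. exact: map_cat. Qed.

Lemma word_map_cat V W p : word_map (V ++ W) p = word_map V (word_map W p).
Proof.
rewrite /word_map row_of_cat !wratio_cat !wshift_cat /=; congr pair; ring.
Qed.

Context (m_ge2 : (2 <= m)%N) (n_ge1 : forall i, (1 <= n i)%N)
  (ab : forall (i : 'I_m) (j : 'I_(n i)), 0 < a j /\ a j < b i)
  (b_lt1 : forall i, b i < 1)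
  (d_range : forall i, 0 <= d i /\ d i < 1)
  (d_gap : forall i i' : 'I_m, i' = i.+1 :> nat -> d i + b i <= d i')
  (d_last : forall i : 'I_m, i.+1 = m -> d i + b i <= 1)
  (c_range : forall (i : 'I_m) (j : 'I_(n i)), 0 <= c j /\ c j < 1)
  (c_gap : forall (i : 'I_m) (j j' : 'I_(n i)),
    j' = j.+1 :> nat -> c j + a j <= c j')
  (c_last : forall (i : 'I_m) (j : 'I_(n i)),
    j.+1 = n i -> c j + a j <= 1)
  (S_limit : is_limit_set a c b d S).

Definition first_letter (i : 'I_m) : letter :=
  letter_of (Ordinal (n_ge1 i)).

Lemma xratio_lt l : 0 < xratio l /\ xratio l < b (tag l).
Proof. by case: l => i j; exact: ab. Qed.

Lemma carpet_bounds : exists lo hi : R, [/\ 0 < lo, lo <= hi, hi < 1,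
  (forall i, alphabet xratio xshift lo hi (cols i)) &
  alphabet b d lo hi rows].
Proof.
have [lo lo0 hlo] := @finite_min R letter xratio (fun l => (xratio_lt l).1).
have [hi hi1 hhi] := @finite_max R _ b b_lt1.
have hab i : lo <= b i.
  have := hlo (first_letter i); have [_] := xratio_lt (first_letter i) => /=.
  by move=> h1 h2; apply: le_trans (ltW h1).
exists lo, hi; split => //.
- have i0 : 'I_m by exact: (Ordinal (ltnW m_ge2)).
  exact: le_trans (hab i0) (hhi i0).
- move=> i; split; last first.
    move=> l; rewrite mem_cols => /eqP li; rewrite hlo /=.
    have [_ h] := xratio_lt l; exact: le_trans (ltW h) (hhi _).
  apply: ordered_enum => [j|j j'|j] /=.
  + by have [] := c_range j.
  + exact: c_gap.
  + exact: c_last.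
- split; last by move=> i _; rewrite hab hhi.
  apply: ordered_enum => [i|i i'|i] /=.
  + by have [] := d_range i.
  + exact: d_gap.
  + exact: d_last.
Qed.

Lemma word_map_limit W p : S p -> S (word_map W p).
Proof.
have [_ _ SE] := S_limit.
elim: W => [|l W IH] Sp.
  by rewrite /word_map /wratio /= !big_nil !mul1r !addr0; case: p Sp.
rewrite -cat1s word_map_cat SE; exists (tag l) => //; exists (tagged l) => //.
exists (word_map W p); first exact: IH.
rewrite /carpet_map [in RHS]/word_map /wratio /= !big_seq1 !mulr0 !addr0.
by rewrite /xratio /xshift.
Qed.

Lemma word_map_letter l p : word_map [:: l] p = @carpet_map R m n a c b d (tag l) (tagged l) p.
Proof. by rewrite /word_map /carpet_map /wratio /= !big_seq1 !mulr0 !addr0. Qed.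

Lemma address k p : S p -> exists W q, [/\ size W = k, S q & p = word_map W q].
Proof.
have [_ _ SE] := S_limit.
elim: k p => [|k IH] p Sp.
  exists [::], p; split=> //.
  by rewrite /word_map /wratio /= !big_nil !mul1r !addr0; case: p Sp.
move: (Sp); rewrite {1}SE => -[i _ [j _ [q Sq <-]]].
have [W [q' [szW Sq' qE]]] := IH q Sq.
exists (letter_of j :: W), q'; split => //=; first by rewrite szW.
by rewrite -cat1s word_map_cat -qE word_map_letter.
Qed.

Context (lo hi : R) (lo0 : 0 < lo) (lohi : lo <= hi) (hi1 : hi < 1)
  (hcols : forall i, alphabet xratio xshift lo hi (cols i))
  (hrows : alphabet b d lo hi rows).

Lemma alphabets_cols w : alphabets xratio xshift lo hi (map cols w).
Proof. by move=> A /mapP[i _ ->]. Qed.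

Lemma alphabets_rows k : alphabets b d lo hi (nseq k rows).
Proof. by move=> A /nseqP[->]. Qed.

Lemma fits_row_of W : fits W (map cols (row_of W)).
Proof. by rewrite fits_cols. Qed.

Lemma xratio_gt0 W : 0 < wratio xratio W.
Proof. exact: (wratio_gt0 lo0 (@alphabets_cols (row_of W)) (fits_row_of W)). Qed.

Lemma yratio_gt0 w : 0 < wratio b w.
Proof. exact: (wratio_gt0 lo0 (@alphabets_rows (size w)) (fits_rows w)). Qed.

(** The comparison a < b of the letters makes every cylinder of the carpet at
    least as high as it is wide. *)
Lemma xratio_le W : wratio xratio W <= wratio b (row_of W).
Proof.
elim: W => [|l W IH]; first by rewrite /wratio !big_nil.
rewrite /= !wratio_cons ler_pM ?(ltW (xratio_gt0 _))//.
  by have [/ltW] := xratio_lt l.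
by have [_ /ltW] := xratio_lt l.
Qed.

Lemma xshift_range W : 0 <= wshift xratio xshift W /\
  wshift xratio xshift W + wratio xratio W <= 1.
Proof. exact: (wshift_range lo0 (@alphabets_cols (row_of W)) (fits_row_of W)). Qed.

Lemma yshift_range w : 0 <= wshift b d w /\ wshift b d w + wratio b w <= 1.
Proof. exact: (wshift_range lo0 (@alphabets_rows (size w)) (fits_rows w)). Qed.

Lemma yratio_le_hi w : wratio b w <= hi ^+ size w.
Proof. exact: (wratio_le_hi lo0 (@alphabets_rows (size w)) (fits_rows w)). Qed.

Lemma xratio_le_hi W : wratio xratio W <= hi ^+ size W.
Proof. exact: (wratio_le_hi lo0 (@alphabets_cols (row_of W)) (fits_row_of W)). Qed.

(** S is bounded, and each of its points lies in the image of S under words of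
    any length; these images shrink towards cylinders contained in the unit
    square. *)
Lemma limit_unit p : S p -> (0 <= p.1 <= 1) /\ (0 <= p.2 <= 1).
Proof.
have [cS _ _] := S_limit.
have [B B0 hB] := compact_plane_bounded cS.
have hi0 : 0 <= hi by apply: le_trans lohi; exact: ltW.
move=> Sp.
suff H (e : R) : 0 < e -> (- e <= p.1 <= 1 + e) /\ (- e <= p.2 <= 1 + e).
  have h1 (x : R) : (forall e : R, 0 < e -> - e <= x <= 1 + e) -> 0 <= x <= 1.
    move=> h; apply/andP; split; apply/ler_addgt0Pr => e e0.
      by have /andP[] := h e e0; lra.
    by have /andP[] := h e e0.
  by split; apply: h1 => e e0; have [] := H e e0.
move=> e0.
have [k hk] : exists k, hi ^+ k <= e / (B + 1).
  by apply: expr_small => //; rewrite divr_gt0//; lra.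
have [W [q [szW Sq ->]]] := address k Sp.
have key (r s x : R) : 0 < r -> r <= hi ^+ k -> 0 <= s -> s + r <= 1 -> `|x| <= B ->
    - e <= r * x + s <= 1 + e.
  move=> r0 rk s0 s1; rewrite ler_norml => /andP[x1 x2].
  have : r * (B + 1) <= e.
    by rewrite -ler_pdivlMr; [exact: le_trans rk hk|lra].
  by move=> h; apply/andP; split; nra.
have [q1 q2] := hB q Sq.
have [s1 s2] := xshift_range W; have [s3 s4] := yshift_range (row_of W).
split; apply: key => //.
- exact: xratio_gt0.
- by rewrite -szW xratio_le_hi.
- exact: yratio_gt0.
- by rewrite -szW (le_trans (yratio_le_hi _))// size_map.
Qed.

Lemma word_map_cylinder W p : S p ->
  cylinder xratio xshift W (word_map W p).1 /\ cylinder b d (row_of W) (word_map W p).2.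
Proof.
move=> /limit_unit[/andP[x0 x1] /andP[y0 y1]]; rewrite /cylinder /= !in_itv /=.
have xr := xratio_gt0 W; have yr := yratio_gt0 (row_of W).
by split; apply/andP; split; nra.
Qed.

(** * Uniform disconnectedness of the carpet *)

Lemma row_address k (t : R) p : S p -> exists W q,
  [/\ row_of W \in stopping b (nseq k rows) t, S q & p = word_map W q].
Proof.
move=> Sp; have [W [q [szW Sq pE]]] := address k Sp.
have szr : size (row_of W) = k by rewrite size_map.
have := fits_rows (row_of W); rewrite szr => /(stopping_prefix b t)[w wst [w' wE]].
exists (take (size w) W), (word_map (drop (size w) W) q); split.
- by rewrite /row_of map_take -/(row_of W) wE take_size_cat.
- exact: word_map_limit.
- by rewrite -word_map_cat cat_take_drop.
Qed.

Lemma stopping_rows_hi k (t : R) w : hi ^+ k <= t ->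
  w \in stopping b (nseq k rows) t -> wratio b w <= t.
Proof.
move=> kt; apply: (stopping_hi lo0 (@alphabets_rows k)) => v vf.
by have := yratio_le_hi v; rewrite (fits_size vf) size_nseq => /le_trans; apply.
Qed.

(** The number of cylinders of length about t that start in a window of length
    M * lo * t does not depend on t: their left ends are separated by lo * t. *)
Lemma size_stopping_near (L : eqType) (rho tau : L -> R) As (t x M : R) :
  alphabets rho tau lo hi As -> 0 < t -> 0 <= M ->
  (size [seq w <- stopping rho As t |
     x <= wshift rho tau w <= x + M * (lo * t)])%:R <= M + 1.
Proof.
move=> hAs t0 M0.
have [t1|/ltW t1] := lerP 1 t.
  have -> : stopping rho As t = [:: [::]] by case: (As) => //= ? ?; rewrite t1.
  by apply: (@le_trans _ _ 1); [rewrite /=; case: ifP => _; rewrite ?ler01|rewrite lerDr].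
have lo1 : lo <= 1 by exact: le_trans lohi (ltW hi1).
apply: (@size_separated _ _ _ (wshift rho tau) x (lo * t)) => //.
- exact: mulr_gt0.
- apply: filter_uniq; exact: (stopping_uniq lo0 _ hAs).
- by move=> v; rewrite mem_filter => /andP[].
move=> v w; rewrite !mem_filter => /andP[_ vs] /andP[_ ws] vw.
have v1 := stopping_lo lo0 hAs lo1 t0 t1 vs.
have w1 := stopping_lo lo0 hAs lo1 t0 t1 ws.
have [h|h] := stopping_sep lo0 hAs vs ws vw.
  by rewrite distrC; apply: le_trans (ler_norm _); lra.
by apply: le_trans (ler_norm _); lra.
Qed.

Section Disconnected.
Context (gam : R) (gam0 : 0 < gam)
  (gcols : forall i, gapped xratio xshift gam (cols i))
  (grows : gapped b d gam rows).

Local Notation X := (set_type S : metricType R).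
Local Notation pos := (@plane_pt R S).

Let kap := gam * lo / 4.

Let gam1 : gam <= 1.
Proof. by have [g [g0 g1 _]] := grows; lra. Qed.

Let lo1 : lo <= 1.
Proof. exact: le_trans lohi (ltW hi1). Qed.

Let kap0 : 0 < kap.
Proof. by rewrite divr_gt0// mulr_gt0. Qed.

Let kap1 : kap <= 1.
Proof.
have h : gam * lo <= 1 by rewrite mulr_ile1// ltW.
by rewrite /kap; lra.
Qed.

(** The vertical projection of S is porous: an interval covered by a chain
    contains a gap of proportional length, over which the chain has to jump. *)
Lemma chain_height_le (e : R) (x y : X) : 0 <= e -> chain e x y ->
  `|(pos x).2 - (pos y).2| <= e / kap.
Proof.
move=> e0.
wlog xy : x y / (pos x).2 <= (pos y).2.
  move=> h cxy; case/orP: (le_total (pos x).2 (pos y).2); first by move=> /h; apply.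
  by move=> /h; rewrite distrC; apply; exact: chain_sym.
move=> [s xs sy].
have [->|ne] := eqVneq (pos x).2 (pos y).2.
  by rewrite subrr normr0 divr_ge0// ltW.
have {xy ne} xy : (pos x).2 < (pos y).2 by rewrite lt_neqAle ne.
rewrite distrC gtr0_norm ?subr_gt0// ler_pdivlMr// mulrC.
have [_ /andP[x0 x1]] := limit_unit (plane_ptP x).
have [_ /andP[y0 y1]] := limit_unit (plane_ptP y).
have hi0 : 0 <= hi by apply: le_trans lohi; exact: ltW.
have [|k hk] := expr_small hi0 hi1 (e := ((pos y).2 - (pos x).2) / 4).
  by rewrite divr_gt0// subr_gt0.
have rk : rcons (nseq k rows) rows = nseq k.+1 rows.
  by elim: (k) => //= j ->.
have hA : alphabets b d lo hi (rcons (nseq k rows) rows).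
  by rewrite rk; exact: alphabets_rows.
have hG B : B \in rcons (nseq k rows) rows -> gapped b d gam B.
  by rewrite rk => /nseqP[->].
have hR w : fits w (nseq k rows) -> wratio b w <= ((pos y).2 - (pos x).2) / 4.
  move=> wf; apply: le_trans hk.
  by have := yratio_le_hi w; rewrite (fits_size wf) size_nseq.
have hL : (pos y).2 - (pos x).2 <= 1 by lra.
have [p [q [px qy pq av]]] := porous lo0 hA lo1 gam0 hG xy hL hR.
rewrite -pq; apply: (@path_jump _ X (fun z => (pos z).2) e p q x s) => //.
- by move=> u v; exact: mdist_ge_snd.
- move=> z _; have [W [z' [szW Sz' zE]]] := address k.+1 (plane_ptP z).
  apply: (av (row_of W)); last by rewrite zE; have [] := word_map_cylinder W Sz'.
  by rewrite rk -szW -(size_map tag W); exact: fits_rows.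
- by rewrite sy.
Qed.

(** By the vertical estimate a chain with steps e stays in a strip of height
    h, a multiple of e, met by a bounded number of rows of height about h.
    Within each of these rows the horizontal projection of S is porous down to
    the scale h, because cylinders of height h are at most h wide. So a wide
    chain spans a gap common to all these rows, of length proportional to its
    width, over which it has to jump. *)
Lemma chain_width_le : exists2 C, 0 < C &
  forall (e : R) (x y : X), 0 < e -> chain e x y ->
  `|(pos x).1 - (pos y).1| <= C * e.
Proof.
(* K bounds the number of rows of height about h that can meet the strip. *)
pose K := (Num.truncn (3 / lo + 1)).+1.
have kK : 0 < kap ^+ K by rewrite exprn_gt0.
exists (kap^-1 + 4 / lo / kap / kap ^+ K + (kap ^+ K)^-1).
  by rewrite !addr_gt0 ?invr_gt0// !mulr_gt0 ?invr_gt0.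
move=> e x y e0.
wlog xy : x y / (pos x).1 <= (pos y).1.
  move=> h cxy; case/orP: (le_total (pos x).1 (pos y).1); first by move=> /h; apply.
  by move=> /h; rewrite distrC; apply; exact: chain_sym.
move=> [s xs sy]; rewrite distrC ger0_norm ?subr_ge0//.
have e1 : 0 < e / kap by rewrite divr_gt0.
have e2 : 0 < 4 / lo / kap / kap ^+ K * e by rewrite !mulr_gt0 ?invr_gt0.
have e3 : 0 < (kap ^+ K)^-1 * e by rewrite mulr_gt0 ?invr_gt0.
rewrite 2!mulrDl [kap^-1 * e]mulrC.
have [/andP[x0 x1] _] := limit_unit (plane_ptP x).
have [/andP[y0 y1] _] := limit_unit (plane_ptP y).
pose h := e / kap; rewrite -/h in e1 *.
have [h1|h1] := lerP 1 h; first by lra.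
have [->|ne] := eqVneq (pos x).1 (pos y).1; first by lra.
have {ne} xy' : (pos x).1 < (pos y).1 by rewrite lt_neqAle ne.
have hi0 : 0 <= hi by apply: le_trans lohi; exact: ltW.
have [k hk] := expr_small hi0 hi1 e1.
pose F := [seq w <- stopping b (nseq k rows) h |
  (pos x).2 - 2 * h <= wshift b d w <= (pos x).2 - 2 * h + 3 / lo * (lo * h)].
have FK : (size F < K)%N.
  rewrite /K ltnS truncn_ge_nat; last by rewrite addr_ge0// divr_ge0// ltW.
  apply: size_stopping_near; [exact: alphabets_rows|by []|].
  by rewrite divr_ge0// ltW.
have kF : kap ^+ K <= kap ^+ size F.
  by rewrite ler_wiXn2l ?(ltW kap0)// ltnW.
have [small|large] := lerP (kap ^+ size F * ((pos y).1 - (pos x).1) / 4) (h / lo).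
  apply: (@le_trans _ _ (4 / lo / kap / kap ^+ K * e)); last by lra.
  have -> : 4 / lo / kap / kap ^+ K * e = (h / lo * 4) / kap ^+ K.
    by rewrite /h; field; rewrite !gt_eqF.
  rewrite ler_pdivlMr// mulrC -ler_pdivrMr// (le_trans _ small)//.
  by rewrite ler_pM2r// ler_wpM2r// subr_ge0.
have hL : (pos y).1 - (pos x).1 <= 1 by lra.
have hA As : As \in map (map cols) F -> alphabets xratio xshift lo hi As /\
    (forall A, A \in As -> gapped xratio xshift gam A).
  move=> /mapP[w _ ->]; split; first exact: alphabets_cols.
  by move=> _ /mapP[i _ ->].
have hW As : As \in map (map cols) F -> exists As0 A, As = rcons As0 A /\
    forall W, fits W As0 -> wratio xratio W <=
      (gam * lo / 4) ^+ size (map (map cols) F) * ((pos y).1 - (pos x).1) / 4.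
  move=> /mapP[w + ->]; rewrite mem_filter => /andP[_ wst].
  have wh := stopping_rows_hi hk wst.
  case/lastP: w wh {wst} => [|w0 i]; first by rewrite wratio_nil; lra.
  rewrite -cats1 wratio_cat [wratio b [:: i]]wratio_cons wratio_nil mulr1 => wh.
  exists (map cols w0), (cols i); split; first by rewrite map_cat cats1.
  move=> W; rewrite fits_cols => /eqP We.
  rewrite size_map; apply: le_trans (ltW large).
  rewrite (le_trans (xratio_le W))// We ler_pdivlMr//; apply: le_trans wh.
  have [_ /(_ i)] := hrows; rewrite /rows map_id mem_enum => /(_ isT)/andP[lob _].
  by rewrite ler_pM2l// yratio_gt0.
have [p [q [px qy pq av]]] := porous_seq lo0 lo1 gam0 gam1 xy' hL hA hW.
rewrite size_map in pq.
have : q - p <= e.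
  apply: (@path_jump _ X (fun z => (pos z).1) e p q x s) => //.
  - by move=> u v; exact: mdist_ge_fst.
  - exact: ltW.
  - move=> z zs; have cz := chain_mem xs zs.
    have := chain_height_le (ltW e0) cz; rewrite -/h ler_norml => /andP[z1 z2].
    have [W [q' [Wst Sq' zE]]] := row_address k h (plane_ptP z).
    have Wh := stopping_rows_hi hk Wst.
    have [cx cy] := word_map_cylinder W Sq'; rewrite -zE in cx cy.
    apply: (av (map cols (row_of W))) cx; last exact: fits_row_of.
    apply: map_f; rewrite mem_filter Wst andbT.
    move: cy; rewrite /cylinder /= in_itv /= => /andP[c1 c2].
    have -> : 3 / lo * (lo * h) = 3 * h by field; rewrite gt_eqF.
    by apply/andP; split; lra.
  - by rewrite sy.
rewrite pq => le_e.
apply: (@le_trans _ _ ((kap ^+ K)^-1 * e)); last by lra.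
rewrite mulrC ler_pdivlMr// mulrC; apply: le_trans le_e.
by rewrite ler_wpM2r// subr_ge0.
Qed.

(** The two estimates need e > 0; the case e = 0 follows by letting e decrease
    to 0. *)
Lemma carpet_uniformly_disconnected : exists2 C, 0 < C &
  @uniformly_disconnected R X C.
Proof.
have [C C0 hC] := chain_width_le.
have C'0 : 0 < C + kap^-1 by rewrite addr_gt0 ?invr_gt0.
exists (C + kap^-1) => // e x y e0 cxy.
rewrite -ler_pdivrMl//; apply/ler_addgt0Pr => del del0.
have ed : 0 < e + del by lra.
have cxy' : chain (e + del) x y by apply: chain_le cxy; lra.
rewrite ler_pdivrMl// mdist_subset (le_trans (mdist_leD _ _))// mulrDl.
by rewrite lerD ?hC// mulrC chain_height_le// ltW.
Qed.

End Disconnected.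

(** * Covering the carpet *)

Section Upper.
Context (sx sy : R) (sx0 : 0 <= sx) (sy0 : 0 <= sy)
  (sumx : forall i, \sum_(l <- cols i) xratio l `^ sx <= 1)
  (sumy : \sum_(i <- rows) b i `^ sy <= 1).

Local Notation X := (set_type S : metricType R).
Local Notation pos := (@plane_pt R S).

(** A ball of radius rho meets boundedly many rows w of height about rho, and
    in each of them boundedly many columns u of width about rho. The resulting
    approximate square is cut into rows w ++ v of height about r, and each of
    these into columns u ++ u' of width about r. The number of words v is
    controlled by the vertical exponent, that of words u' by the horizontal
    one. The words u and u ++ u' are prefixes of column words over w ++ v,
    since cylinders are at least as high as they are wide. *)
Lemma carpet_doubling : @doubling_bound R X (sx + sy).
Proof.
have lo1 : lo <= 1 by exact: le_trans lohi (ltW hi1).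
have hi0 : 0 <= hi by apply: le_trans lohi; exact: ltW.
pose M := 3 / lo + 1.
have M0 : 0 < M by rewrite addr_gt0// divr_gt0.
exists (M * M * (4 / lo) `^ (sx + sy)).
  by rewrite !mulr_gt0// powR_gt0// divr_gt0.
move=> r rho r0 rrho x.
have rho0 : 0 < rho by exact: lt_le_trans rrho.
pose r' := r / 4; have r'0 : 0 < r' by rewrite divr_gt0.
have r'rho : r' <= rho by rewrite /r'; lra.
have [k hk] := expr_small hi0 hi1 r'0.
pose T := 4 * rho / r.
have T1 : 1 <= T by rewrite /T ler_pdivlMr//; lra.
have T0 : 0 < T by lra.
have near_pos (y : X) : ball x rho y ->
    `|(pos x).1 - (pos y).1| < rho /\ `|(pos x).2 - (pos y).2| < rho.
  rewrite ballEmdist /= mdist_subset => h.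
  by split; apply: le_lt_trans h; [exact: mdist_ge_fst|exact: mdist_ge_snd].
(* Cylinders of length at most rho that meet a window of radius rho start in
   a window of length 3 * rho. *)
have near_shift (z p s q : R) : `|z - p| < rho -> s <= p <= s + q -> q <= rho ->
    z - 2 * rho <= s <= z - 2 * rho + 3 / lo * (lo * rho).
  have -> : 3 / lo * (lo * rho) = 3 * rho by field; rewrite gt_eqF.
  by rewrite ltr_norml => /andP[h1 h2] /andP[h3 h4] h5; apply/andP; split; lra.
have -> : M * M * (4 / lo) `^ (sx + sy) * (rho / r) `^ (sx + sy) =
    M * ((T / lo) `^ sy * (M * ((T / lo) `^ sx * 1))).
  have e : (4 / lo) `^ (sx + sy) * (rho / r) `^ (sx + sy) =
      (T / lo) `^ sx * (T / lo) `^ sy.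
    rewrite -powRM ?divr_ge0 ?(ltW rho0) ?(ltW r0) ?(ltW lo0)//.
    have -> : 4 / lo * (rho / r) = T / lo by rewrite /T; field; rewrite !gt_eqF.
    by rewrite powRD// (gt_eqF (divr_gt0 T0 lo0)) implybT.
  by rewrite -mulrA e; ring.
have B0 : 0 <= (T / lo) `^ sx * 1 by rewrite mulr1 powR_ge0.
have B1 : 0 <= M * ((T / lo) `^ sx * 1) by rewrite mulr_ge0// ltW.
have B2 : 0 <= (T / lo) `^ sy * (M * ((T / lo) `^ sx * 1)).
  by rewrite mulr_ge0// powR_ge0.
apply: (@coverable_bigcup _ X _
  [seq w <- stopping b (nseq k rows) rho | (pos x).2 - 2 * rho <= wshift b d w
     <= (pos x).2 - 2 * rho + 3 / lo * (lo * rho)] _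
  (fun w => [set y : X | ball x rho y /\ exists W q,
     [/\ row_of W = w, S q & pos y = word_map W q]])) => //.
- apply: size_stopping_near => //; first exact: alphabets_rows.
  by rewrite divr_ge0// ltW.
- move=> y xy; have [W [q [Wst Sq yE]]] := row_address k rho (plane_ptP y).
  exists (row_of W) => /=; last by split => //; exists W, q.
  rewrite mem_filter Wst andbT; have [_ xy2] := near_pos y xy.
  apply: near_shift xy2 _ (stopping_rows_hi (le_trans hk r'rho) Wst).
  by have [_] := word_map_cylinder W Sq; rewrite -yE /cylinder /= in_itv.
move=> w; rewrite mem_filter => /andP[_ wst].
have w_rho := stopping_rows_hi (le_trans hk r'rho) wst.
have w0 := yratio_gt0 w; have [w_ge0 w_le1] := yshift_range w.
have t0 : 0 < r' / wratio b w by rewrite divr_gt0.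
have Tr : r'^-1 * rho = T by rewrite /T /r'; field; rewrite gt_eqF.
have kt : hi ^+ k <= r' / wratio b w.
  apply: (le_trans hk); rewrite ler_pdivlMr// ler_piMr ?(ltW r'0)//; lra.
apply: (@coverable_bigcup _ X _ (stopping b (nseq k rows) (r' / wratio b w)) _
  (fun v => [set y : X | ball x rho y /\ exists W q,
     [/\ row_of W = w ++ v, S q & pos y = word_map W q]])) => //.
- apply: (size_stopping_le lo0 (@alphabets_rows k)) => //.
    by move=> A /nseqP[->].
  by rewrite invf_div mulrC -Tr ler_wpM2l// invr_ge0 ltW.
- move=> y [xy [W [q [Ww Sq yE]]]].
  have [V [q' [Vst Sq' qE]]] := row_address k (r' / wratio b w) Sq.
  exists (row_of V) => //=; split => //; exists (W ++ V), q'; split => //.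
    by rewrite row_of_cat Ww.
  by rewrite word_map_cat -qE.
move=> v vst.
have v_r : wratio b (w ++ v) <= r'.
  by rewrite wratio_cat mulrC -ler_pdivlMr//; exact: stopping_rows_hi kt vst.
have hx_rho W : fits W (map cols (w ++ v)) -> wratio xratio W <= r'.
  by rewrite fits_cols => /eqP We; apply: le_trans (xratio_le W) _; rewrite We.
apply: (@coverable_bigcup _ X _
  [seq u <- stopping xratio (map cols (w ++ v)) rho |
     (pos x).1 - 2 * rho <= wshift xratio xshift u
     <= (pos x).1 - 2 * rho + 3 / lo * (lo * rho)] _
  (fun u => [set y : X | ball x rho y /\ exists U q,
     [/\ row_of (u ++ U) = w ++ v, S q & pos y = word_map (u ++ U) q]])) => //.
- apply: size_stopping_near => //; first exact: alphabets_cols.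
  by rewrite divr_ge0// ltW.
- move=> y [xy [W [q [Ww Sq yE]]]].
  have : fits W (map cols (w ++ v)) by rewrite fits_cols Ww.
  move=> /(stopping_prefix xratio rho)[u ust [U WE]].
  exists u => /=; last by split => //; exists U, q; rewrite -WE.
  rewrite mem_filter ust andbT; have [xy1 _] := near_pos y xy.
  apply: near_shift xy1 _ (stopping_hi lo0 (@alphabets_cols (w ++ v)) _ ust); last first.
    by move=> W' /hx_rho /le_trans; apply.
  have := (word_map_cylinder u (word_map_limit U Sq)).1.
  by rewrite -word_map_cat -WE -yE /cylinder /= in_itv.
move=> u; rewrite mem_filter => /andP[_ ust].
have u0 := xratio_gt0 u.
have u_rho : wratio xratio u <= rho.
  apply: (stopping_hi lo0 (@alphabets_cols (w ++ v)) _ ust).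
  by move=> W' /hx_rho /le_trans; apply.
have uf := stopping_fits ust.
set As := drop (size u) (map cols (w ++ v)).
have AsA : alphabets xratio xshift lo hi As.
  by apply: alphabets_drop; exact: alphabets_cols.
have uAs U : fits U As -> fits (u ++ U) (map cols (w ++ v)).
  by move=> Uf; rewrite -[map cols _](cat_take_drop (size u)); exact: fits_cat.
apply: (@coverable_bigcup _ X _ (stopping xratio As (r' / wratio xratio u)) _
  (fun u' => [set y : X | ball x rho y /\ exists U q,
     [/\ row_of (u ++ u' ++ U) = w ++ v, S q & pos y = word_map (u ++ u' ++ U) q]])) => //.
- apply: (size_stopping_le lo0 AsA) => //.
  + by move=> A /mem_drop /mapP[i _ ->].
  + by rewrite divr_gt0.
  + by rewrite invf_div mulrC -Tr ler_wpM2l// invr_ge0 ltW.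
- move=> y [xy [U [q [Uw Sq yE]]]].
  have : fits U As.
    have : fits (u ++ U) (map cols (w ++ v)) by rewrite fits_cols Uw.
    by move=> /(fits_drop (size u)); rewrite drop_size_cat.
  move=> /(stopping_prefix xratio (r' / wratio xratio u))[u' u'st [U' UE]].
  by exists u' => //=; split => //; exists U', q; rewrite -UE.
move=> u' u'st.
have u'_r : wratio xratio (u ++ u') <= r'.
  rewrite wratio_cat mulrC -ler_pdivlMr//; apply: (stopping_hi lo0 AsA _ u'st).
  move=> U Uf; rewrite ler_pdivlMr// mulrC -wratio_cat; exact: hx_rho (uAs _ Uf).
set P := (P in coverable P).
have small y z : P y -> P z -> mdist y z < r.
  move=> [_ [U [q [Uw Sq yE]]]] [_ [U2 [q2 [U2w Sq2 zE]]]].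
  rewrite mdist_subset; apply: le_lt_trans (mdist_leD _ _) _.
  have [_] := word_map_cylinder (u ++ u' ++ U) Sq.
  have [_] := word_map_cylinder (u ++ u' ++ U2) Sq2.
  have [+ _] := word_map_cylinder (u ++ u') (word_map_limit U Sq).
  have [+ _] := word_map_cylinder (u ++ u') (word_map_limit U2 Sq2).
  rewrite -!word_map_cat -!catA Uw U2w -yE -zE /cylinder /= !in_itv /=.
  move=> /andP[z1 z2] /andP[y1 y2] /andP[z3 z4] /andP[y3 y4].
  have rE : r = 4 * r' by rewrite /r'; field.
  have : `|(pos y).1 - (pos z).1| <= r' by rewrite ler_norml; apply/andP; split; lra.
  have : `|(pos y).2 - (pos z).2| <= r' by rewrite ler_norml; apply/andP; split; lra.
  by rewrite -/(pos y) -/(pos z); lra.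
have [[z Pz]|Pno] := pselect (P !=set0); last first.
  by exists [::]; split => // y Py; exfalso; apply: Pno; exists y.
exists [:: z]; split => // y Py; exists z; first by rewrite /= mem_head.
by rewrite ballEmdist /=; exact: small.
Qed.

End Upper.

(** * Ladders in the carpet *)

Section Ladders.
Local Notation X := (set_type S : metricType R).
Let lo1 : lo <= 1.
Proof. exact: le_trans lohi (ltW hi1). Qed.

Let hi0 : 0 <= hi.
Proof. by apply: le_trans lohi; exact: ltW. Qed.

Lemma row_of_nseq k l : row_of (nseq k l) = nseq k (tag l).
Proof. exact: map_nseq. Qed.

Lemma row_of_first w : row_of (map first_letter w) = w.
Proof. by rewrite /row_of -map_comp; apply: map_id_in. Qed.

Lemma word_map_cat_x V W p : (word_map (V ++ W) p).1 =
  wshift xratio xshift V + wratio xratio V * (word_map W p).1.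
Proof. by rewrite word_map_cat /= addrC. Qed.

Lemma word_map_cat_y V W p : (word_map (V ++ W) p).2 =
  wshift b d (row_of V) + wratio b (row_of V) * (word_map W p).2.
Proof. by rewrite word_map_cat /= addrC. Qed.

(** In the row of l0 the powers of the horizontal ratio decrease faster than
    those of the vertical one. So for large k the first power l of the
    horizontal ratio that is below the k-th power of the vertical ratio leaves
    K0 letters to spare, which serve to descend further inside an approximate
    square. *)
Lemma matching_scale l0 (K0 : nat) : exists k l : nat, [/\ (l + K0 <= k)%N,
  wratio xratio (nseq l l0) <= wratio b (nseq k (tag l0)) &
  lo * wratio b (nseq k (tag l0)) <= wratio xratio (nseq l l0)].
Proof.
have [al0 alb] := xratio_lt l0; set be := b (tag l0) in alb *; set al := xratio l0 in al0 alb *.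
have be0 : 0 < be by exact: lt_trans alb.
have [|||j hj] := @expr_small R (al / be) (be ^+ K0.+1).
- by rewrite divr_ge0// ltW.
- by rewrite ltr_pdivrMr// mul1r.
- by rewrite exprn_gt0.
pose k := (j + K0.+1)%N.
have hjk : al ^+ j <= be ^+ k.
  by move: hj; rewrite expr_div_n ler_pdivrMr ?exprn_gt0// mulrC -exprD.
have ex : exists l : nat, al ^+ l <= be ^+ k by exists j.
exists k, (ex_minn ex); case: ex_minnP => l hl lmin; split.
- by rewrite (leq_trans (leq_add (lmin _ hjk) (leqnn _)))// leq_add2l.
- by rewrite !wratio_nseq.
rewrite !wratio_nseq -/al -/be.
case: l hl lmin => [|l] hl lmin.
  rewrite expr0 in hl *; rewrite mulr_ile1 ?exprn_ile1 ?exprn_ge0 ?(ltW be0) ?(ltW (b_lt1 _))//.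
  exact: ltW.
rewrite exprS; have [_ /(_ l0)] := hcols (tag l0); rewrite mem_cols eqxx => /(_ isT)/andP[lal _].
rewrite ler_pM ?exprn_ge0 ?(ltW be0) ?(ltW lo0)//.
rewrite leNgt; apply/negP => h; have := lmin l (ltW h); by rewrite ltnn.
Qed.

Lemma two_cols i : (2 <= n i)%N -> exists l l', [/\ l \in cols i, l' \in cols i & l <> l'].
Proof.
move=> n2; exists (letter_of (Ordinal (n_ge1 i))), (letter_of (Ordinal n2)).
rewrite !mem_cols /=; split => // /eqP; rewrite /letter_of -tag_eqE /tag_eq /= eqxx /=.
Qed.

(** If the rows fill [0, 1], a thin cylinder of k letters in row i meets every
    height of its vertical side. Inside the approximate square given by l
    letters, the cylinders of width about 1 / N of the square are the paths. *)
Lemma vertical_ladders i (sx : R) : 0 <= sx -> (2 <= n i)%N ->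
  \sum_(l <- cols i) xratio l `^ sx = 1 -> full b rows ->
  forall N, (0 < N)%N -> ladder X sx (lo ^+ 4 / 2) (lo^-1 + 2) N.
Proof.
move=> sx0 n2 sumx sumb N N0.
have NR : 0 < N%:R :> R by rewrite ltr0n.
have NV : 0 < N%:R^-1 / 4 :> R by rewrite divr_gt0 ?invr_gt0.
have [K1 hK1] := expr_small hi0 hi1 NV.
have hK1' : hi ^+ K1 <= N%:R^-1.
  by apply: (le_trans hK1); rewrite ler_pdivrMr// ler_peMr ?invr_ge0 ?(ltW NR)// ler1n.
have [l1 [l2 [l1c l2c l12]]] := two_cols n2.
have [sfx [sf0 sf1 sf2]] := inner_word lo0 lo1 (hcols i) l1c l2c l12.
pose l0 := first_letter i.
have [k [l [lk h1 h2]]] := matching_scale l0 (K1 + 2).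
have tl0 : tag l0 = i by [].
rewrite tl0 in h1 h2.
(* The paths lie in the cylinders of the words l0 ^ l, v, sfx, completed with
   copies of l0 to k letters in order to have the full height. *)
have [q0 Sq0] : S !=set0 by have [] := S_limit.
apply: (@ladder_strips _ S snd fst _ xratio xshift lo hi (nseq K1 (cols i)) sfx sx
  (wratio xratio (nseq l l0)) (wratio b (nseq k i)) (wshift b d (nseq k i))
  (wshift xratio xshift (nseq l l0))) => //.
- exact: mdist_ge_snd.
- exact: mdist_ge_fst.
- by move=> p q; rewrite addrC; exact: mdist_leD.
- by move=> A /nseqP[->].
- by move=> A /nseqP[->].
- move=> w wf; apply: le_trans hK1'; rewrite -(size_nseq K1 (cols i)) -(fits_size wf).
  exact: xratio_le_hi.
- exact: xratio_gt0.
- exact: xratio_gt0.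
- exact: yratio_gt0.
- apply: (@le_trans _ _ (wratio xratio (nseq l l0))); last exact: h1.
  by rewrite ler_piMl ?(ltW (xratio_gt0 _)) ?lo1.
move=> v q vst qN.
have vf := stopping_fits vst.
have szv : (size v <= K1)%N.
  by have := fits_size vf; rewrite size_take size_nseq; case: ltnP => [/ltnW|_ ->].
have rv : row_of v = nseq (size v) i.
  apply/eqP; rewrite -fits_cols map_nseq.
  by move: vf; rewrite take_nseq// (minn_idPl szv).
have rs : row_of sfx = [:: i; i] by apply/eqP; rewrite -fits_cols.
have q01 : 0 <= (q%:R / N%:R : R) <= 1.
  by rewrite divr_ge0//= ler_pdivrMr// mul1r ler_nat.
have hfull A : A \in nseq K1 rows -> full b A by move=> /nseqP[->].
have [w wf /andP[w1 w2]] := full_cover lo0 (@alphabets_rows K1) hfull q01.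
pose z := word_map (map first_letter w) q0.
have Sz : S z by exact: word_map_limit.
have hz : `|z.2 - q%:R / N%:R| <= N%:R^-1 / 4.
  have [_] := word_map_cylinder (map first_letter w) Sq0.
  rewrite row_of_first -/z /cylinder /= in_itv /= => /andP[z1 z2].
  have : wratio b w <= N%:R^-1 / 4.
    apply: le_trans hK1; rewrite -(size_nseq K1 rows) -(fits_size wf).
    exact: yratio_le_hi.
  by move=> h; rewrite ler_norml; apply/andP; split; lra.
pose pad := nseq (k - (l + size v + 2)) l0.
have rU : row_of (nseq l l0 ++ (v ++ sfx) ++ pad) = nseq k i.
  rewrite !row_of_cat !row_of_nseq rv rs -[[:: i; i]]/(nseq 2 i) -!nseqD.
  by congr nseq; move: lk szv; clear; lia.
exists (word_map (nseq l l0 ++ (v ++ sfx) ++ pad) z); first exact: word_map_limit.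
split.
  rewrite /word_map rU /=; have := yratio_gt0 (nseq k i); set be := wratio b _ => be0.
  have -> : be * z.2 + wshift b d (nseq k i) -
      (wshift b d (nseq k i) + q%:R * (be / N%:R)) = be * (z.2 - q%:R / N%:R) by ring.
  rewrite normrM gtr0_norm// (le_trans (ler_wpM2l (ltW be0) hz))//.
  by rewrite mulrA.
rewrite word_map_cat_x word_map_cat.
have [+ _] := word_map_cylinder (v ++ sfx) (word_map_limit pad Sz).
rewrite /cylinder /= in_itv /= => /andP[c1 c2].
by rewrite !lerD2l !ler_pM2l ?xratio_gt0// c1 c2.
Qed.

(** If row i fills [0, 1] horizontally, the cylinders of k letters in row i
    cover the horizontal side of an approximate square and are much narrower
    than it. Every row v of relative height about 1 / N inside the square
    meets all of them, which gives one path for each v. *)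
Lemma horizontal_ladders i (sy : R) : 0 <= sy ->
  \sum_(j <- rows) b j `^ sy = 1 -> full xratio (cols i) ->
  forall N, (0 < N)%N -> ladder X sy (lo ^+ 4 / 2) (lo^-1 + 2) N.
Proof.
move=> sy0 sumy suma N N0.
have NR : 0 < N%:R :> R by rewrite ltr0n.
have NV : 0 < N%:R^-1 / 4 :> R by rewrite divr_gt0 ?invr_gt0.
have [K1 hK1] := expr_small hi0 hi1 NV.
have hK1' : hi ^+ K1 <= N%:R^-1.
  by apply: (le_trans hK1); rewrite ler_pdivrMr// ler_peMr ?invr_ge0 ?(ltW NR)// ler1n.
pose i1 : 'I_m := Ordinal (ltnW m_ge2); pose i2 : 'I_m := Ordinal m_ge2.
have mem_rows j : j \in rows by rewrite /rows map_id mem_enum.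
have [//|sfx [sf0 sf1 sf2]] := inner_word lo0 lo1 hrows (mem_rows i1) (mem_rows i2).
pose l0 := first_letter i.
have [k [l [lk h1 h2]]] := matching_scale l0 K1.
have tl0 : tag l0 = i by [].
rewrite tl0 in h1 h2.
(* The points of the path of v come from words that first reach k letters in
   row i, approximating the prescribed horizontal position, and then continue
   in the rows v and sfx. *)
have [q0 Sq0] : S !=set0 by have [] := S_limit.
apply: (@ladder_strips _ S fst snd _ b d lo hi (nseq K1 rows) sfx sy
  (wratio b (nseq k i)) (wratio xratio (nseq l l0))
  (wshift xratio xshift (nseq l l0)) (wshift b d (nseq k i))) => //.
- exact: mdist_ge_fst.
- exact: mdist_ge_snd.
- exact: mdist_leD.
- exact: alphabets_rows.
- by move=> A /nseqP[->].
- move=> w wf; apply: le_trans hK1'; rewrite -(size_nseq K1 rows) -(fits_size wf).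
  exact: yratio_le_hi.
- exact: yratio_gt0.
- exact: yratio_gt0.
- exact: xratio_gt0.
- apply: (@le_trans _ _ (wratio xratio (nseq l l0))); last exact: h1.
  by rewrite ler_piMl ?(ltW (xratio_gt0 _)) ?lo1.
move=> v q vst qN.
have q01 : 0 <= (q%:R / N%:R : R) <= 1.
  by rewrite divr_ge0//= ler_pdivrMr// mul1r ler_nat.
have hfull A : A \in map cols (nseq (k - l) i) -> full xratio A.
  by rewrite map_nseq => /nseqP[->].
have [U Uf /andP[u1 u2]] := full_cover lo0 (@alphabets_cols (nseq (k - l) i)) hfull q01.
have rU : row_of U = nseq (k - l) i by apply/eqP; rewrite -fits_cols.
have lek : (l <= k)%N by move: lk; clear; lia.
have rUU : row_of (nseq l l0 ++ U) = nseq k i.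
  by rewrite row_of_cat row_of_nseq rU -nseqD subnKC.
pose V := map first_letter (v ++ sfx).
have Sz : S (word_map V q0) by exact: word_map_limit.
exists (word_map (nseq l l0 ++ U ++ V) q0); first exact: word_map_limit.
split.
  rewrite word_map_cat_x; have := xratio_gt0 (nseq l l0); set al := wratio xratio _ => al0.
  set z := (word_map (U ++ V) q0).1.
  have hz : `|z - q%:R / N%:R| <= N%:R^-1 / 4.
    have [+ _] := word_map_cylinder U Sz; rewrite -word_map_cat -/z.
    rewrite /cylinder /= in_itv /= => /andP[z1 z2].
    have : wratio xratio U <= N%:R^-1 / 4.
      apply: le_trans hK1; apply: le_trans (xratio_le_hi U) _.
      rewrite -(size_map tag) -/(row_of U) rU size_nseq ler_wiXn2l ?hi0 ?(ltW hi1)//.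
      by move: lk; clear; lia.
    by move=> h; rewrite ler_norml; apply/andP; split; lra.
  have -> : wshift xratio xshift (nseq l l0) + al * z -
      (wshift xratio xshift (nseq l l0) + q%:R * (al / N%:R)) = al * (z - q%:R / N%:R) by ring.
  rewrite normrM gtr0_norm// (le_trans (ler_wpM2l (ltW al0) hz))//.
  by rewrite mulrA.
rewrite catA word_map_cat_y rUU.
have [_] := word_map_cylinder V Sq0; rewrite /V row_of_first.
rewrite /cylinder /= in_itv /= => /andP[c1 c2].
by rewrite !lerD2l !ler_pM2l ?yratio_gt0// c1 c2.
Qed.

End Ladders.

(** * The conformal Assouad dimension of the carpet *)

Lemma carpet_gapped : \sum_(i <- rows) b i < 1 ->
  (forall i, \sum_(l <- cols i) xratio l < 1) ->
  exists2 gam, 0 < gam & gapped b d gam rows /\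
    forall i, gapped xratio xshift gam (cols i).
Proof.
move=> sb sa; have [gy gy0 hy] := sum_lt1_gapped lo0 hrows sb.
have /choice[gx hx] i : exists gx : R, 0 < gx /\ gapped xratio xshift gx (cols i).
  by have [gx gx0 h] := sum_lt1_gapped lo0 (hcols i) (sa i); exists gx.
have [g g0 hg] := finite_min (fun i => (hx i).1).
exists (Num.min gy g); first by rewrite lt_min gy0.
split; first by apply: gappedW hy; rewrite ge_min lexx.
by move=> i; apply: gappedW (hx i).2; rewrite ge_min hg orbT.
Qed.

Lemma conformal_dim_carpet_eq0 : \sum_(i <- rows) b i < 1 ->
  (forall i, \sum_(l <- cols i) xratio l < 1) ->
  conformal_assouad_dim (set_type S : metricType R) = 0%E.
Proof.
move=> sb sa; have [g g0 [gy gx]] := carpet_gapped sb sa.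
have [C C0 hC] := carpet_uniformly_disconnected g0 gx gy.
apply: (conformal_dim_uniformly_disconnected C0 hC (alpha := 1 + 1)); first by rewrite addr_gt0.
apply: carpet_doubling => //.
  move=> i; apply: le_trans (ltW (sa i)); rewrite le_eqVlt; apply/orP; left; apply/eqP.
  by apply: eq_bigr => l _; rewrite powRr1// ltW//; have [] := xratio_lt l.
apply: le_trans (ltW sb); rewrite le_eqVlt; apply/orP; left; apply/eqP.
apply: eq_bigr => i _; rewrite powRr1// ltW//; apply: lt_trans (xratio_lt (first_letter i)).2.
by have [] := xratio_lt (first_letter i).
Qed.

(** The covering bound and the ladders give the same value 1 + s, as an upper
    bound of the Assouad dimension of S and as a lower bound of that of every
    quasi-symmetric image. *)
Lemma conformal_dim_carpet_minimal (s s1 s2 cc C : R) : 0 < s -> 0 <= s1 -> 0 <= s2 ->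
  s1 + s2 = 1 + s ->
  0 < cc -> 0 < C ->
  (forall N, (0 < N)%N -> ladder (set_type S : metricType R) s cc C N) ->
  (forall i, \sum_(l <- cols i) xratio l `^ s1 <= 1) ->
  \sum_(i <- rows) b i `^ s2 <= 1 ->
  conformal_assouad_dim (set_type S : metricType R) =
  assouad_dim (set_type S : metricType R).
Proof.
move=> s0 s10 s20 s12 cc0 C0 hl sx sy.
have h1 : (assouad_dim (set_type S : metricType R) <= (1 + s)%:E)%E.
  apply: ge_ereal_inf; exists (1 + s)%:E => //; exists (1 + s) => //.
  split; first by lra.
  by apply: assouad_boundW; rewrite -s12; exact: carpet_doubling.
have h2 : ((1 + s)%:E <= conformal_assouad_dim (set_type S : metricType R))%E.
  apply: le_ereal_inf_tmp => _ [Y [f [qsf ->]]].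
  apply: le_ereal_inf_tmp => _ [al [_ hal] <-].
  by rewrite lee_fin; exact: ladder_bound s0 cc0 C0 hl qsf hal.
apply/eqP; rewrite eq_le (le_trans h1 h2) andbT.
apply: ge_ereal_inf; exists (assouad_dim (set_type S : metricType R)) => //.
by exists (set_type S : metricType R), idfun; split => //; exact: quasisymmetric_id.
Qed.

(** The sum is a continuous function of the exponent, and at the exponent 1 it
    is at most 1. *)
Lemma cols_powR_root i (x : R) : 0 <= x -> x <= 1 ->
  1 <= \sum_(l <- cols i) xratio l `^ x -> \sum_(l <- cols i) xratio l <= 1 ->
  exists2 e, x <= e & \sum_(l <- cols i) xratio l `^ e = 1.
Proof.
move=> x0 x1 h1 h2.
have h3 : \sum_(l <- cols i) xratio l `^ 1 <= 1.
  apply: le_trans h2; rewrite le_eqVlt; apply/orP; left; apply/eqP.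
  by apply: eq_bigr => l _; rewrite powRr1// ltW//; have [] := xratio_lt l.
have cF : continuous (fun e : R => \sum_(l <- cols i) xratio l `^ e).
  elim: (cols i) => [|l A IH] e.
    rewrite (_ : (fun _ => _) = fun=> 0); first exact: cst_continuous.
    by apply/funext => t; rewrite big_nil.
  rewrite (_ : (fun _ => _) = (fun t : R => xratio l `^ t) \+
      (fun t : R => \sum_(k <- A) xratio k `^ t)); last first.
    by apply/funext => t; rewrite big_cons.
  apply: (@continuousD R R R); last exact: IH.
  have l0 := (xratio_lt l).1.
  rewrite (_ : (fun t : R => _) = fun t => expR (t * ln (xratio l))); last first.
    by apply/funext => t; rewrite /powR gt_eqF.
  apply: (@continuous_comp R R R ( *%R^~ (ln (xratio l))) (@expR R)).
    exact: mulrr_continuous.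
  exact: continuous_expR.
have [|e /andP[e1 e2] he] := @IVT R _ x 1 1 x1 (continuous_subspaceT cF).
  by rewrite ge_min h3 orbT le_max h1.
by exists e.
Qed.

End Carpet.

Lemma gt_powR_id {R : realType} (x e : R) : 0 < x -> x < 1 -> e < 1 -> x < x `^ e.
Proof.
move=> x0 x1 e1; have e0 : 0 < 1 - e by rewrite subr_gt0.
have : x `^ (1 - e) < 1.
  rewrite -[ltRHS](_ : 1 `^ (1 - e) = 1); last by rewrite powR1.
  by rewrite gt0_ltr_powR ?nnegrE// ltW.
rewrite -(ltr_pM2l (powR_gt0 e x0)) mulr1 -powRD ?(gt_eqF x0) ?implybT//.
by rewrite addrC subrK powRr1// ltW.
Qed.

Theorem theorem1p4 (R : realType) (m : nat) (n : 'I_m -> nat)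
  (a c : forall i : 'I_m, 'I_(n i) -> R) (b d : 'I_m -> R)
  (S : set (plane R)) (beta_x beta_y : R)
  (m_ge2 : (2 <= m)%N)
  (n_ge1 : forall i, (1 <= n i)%N)
  (n_ge2 : exists i, (2 <= n i)%N)
  (* (i) *)
  (ab : forall (i : 'I_m) (j : 'I_(n i)), 0 < a i j /\ a i j < b i)
  (b_lt1 : forall i, b i < 1)
  (sum_b : \sum_(i < m) b i <= 1)
  (sum_a : forall i, \sum_(j < n i) a i j <= 1)
  (* (ii) *)
  (d_range : forall i, 0 <= d i /\ d i < 1)
  (d_incr : forall i i' : 'I_m, (i < i')%N -> d i < d i')
  (d_gap : forall i i' : 'I_m, i' = i.+1 :> nat -> d i + b i <= d i')
  (d_last : forall i : 'I_m, i.+1 = m -> d i + b i <= 1)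
  (* (iii) *)
  (c_range : forall (i : 'I_m) (j : 'I_(n i)), 0 <= c i j /\ c i j < 1)
  (c_incr : forall (i : 'I_m) (j j' : 'I_(n i)), (j < j')%N -> c i j < c i j')
  (c_gap : forall (i : 'I_m) (j j' : 'I_(n i)),
    j' = j.+1 :> nat -> c i j + a i j <= c i j')
  (c_last : forall (i : 'I_m) (j : 'I_(n i)),
    j.+1 = n i -> c i j + a i j <= 1)
  (S_limit : is_limit_set a c b d S)
  (beta_y_range : 0 < beta_y /\ beta_y <= 1)
  (beta_y_eq : \sum_(i < m) b i `^ beta_y = 1)
  (beta_x_mem : exists i, \sum_(j < n i) a i j `^ beta_x = 1)
  (beta_x_max : forall e : R,
    (exists i, \sum_(j < n i) a i j `^ e = 1) -> e <= beta_x) :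
  (beta_x < 1 /\ beta_y < 1 ->
     conformal_assouad_dim (set_type S) = 0%E) /\
  (~ (beta_x < 1 /\ beta_y < 1) ->
     conformal_assouad_dim (set_type S) = assouad_dim (set_type S)).
Proof.
have [lo [hi [lo0 lohi hi1 hcols hrows]]] := carpet_bounds m_ge2 n_ge1 ab b_lt1
  d_range d_gap d_last c_range c_gap c_last.
have lo1 : lo <= 1 by apply: le_trans lohi (ltW hi1).
have [by0 by1] := beta_y_range.
have bpos i : 0 < b i.
  by have [h1 h2] := ab i (Ordinal (n_ge1 i)); exact: lt_trans h2.
have apos i j : 0 < a i j by have [] := ab i j.
have alt1 i j : a i j < 1 by have [_ h] := ab i j; exact: lt_trans (b_lt1 i).
have sumx e i : \sum_(l <- cols n i) xratio a l `^ e = \sum_(j < n i) a i j `^ e.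
  exact: (sum_cols i (fun l => xratio a l `^ e)).
have sumx1 i : \sum_(l <- cols n i) xratio a l = \sum_(j < n i) a i j.
  exact: sum_cols.
have sumxr i : \sum_(j < n i) a i j `^ 1 = \sum_(j < n i) a i j.
  by apply: eq_bigr => j _; rewrite powRr1// ltW.
split.
  move=> [bx1 by1'].
  apply: (conformal_dim_carpet_eq0 n_ge1 ab S_limit lo0 lohi hi1 hcols hrows).
    rewrite sum_rows -beta_y_eq; have i0 : 'I_m := Ordinal (ltnW m_ge2).
    rewrite (bigD1 i0)//= [ltRHS](bigD1 i0)//= ltr_leD ?gt_powR_id//.
    by apply: ler_sum => i _; rewrite ltW// gt_powR_id.
  move=> i; rewrite sumx1 lt_neqAle sum_a andbT; apply/eqP => e.
  have : (1 : R) <= beta_x by apply: beta_x_max; exists i; rewrite sumxr.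
  by rewrite leNgt bx1.
move=> nlt.
have root i x : 0 <= x -> x <= 1 -> 1 <= \sum_(j < n i) a i j `^ x ->
    exists2 e, x <= e & \sum_(j < n i) a i j `^ e = 1.
  move=> x0 x1 h; have [||e xe he] := cols_powR_root ab (i := i) x0 x1.
  - by rewrite sumx.
  - by rewrite sumx1.
  by exists e; rewrite -?sumx.
have c0 : 0 < lo ^+ 4 / 2 by rewrite divr_gt0// exprn_gt0.
have C0 : 0 < lo^-1 + 2 by rewrite addr_gt0 ?invr_gt0.
have [i hi_] := beta_x_mem.
have [bx1|bx1] := lerP 1 beta_x.
  (* A row with exponent at least 1 has total width 1; the paths are
     horizontal. *)
  have fulli : full (xratio a) (cols n i).
    rewrite /full sumx1; apply/eqP; rewrite eq_le sum_a -hi_ /=.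
    apply: ler_sum => j _; rewrite ge1r_powR// apos ltW//.
  apply: (conformal_dim_carpet_minimal ab S_limit lo0 lohi hi1 hcols hrows
    by0 ler01 (ltW by0) erefl c0 C0).
  - apply: (horizontal_ladders m_ge2 n_ge1 ab b_lt1 S_limit lo0 lohi hi1 hcols
      hrows (ltW by0) _ fulli).
    by rewrite sum_rows.
  - by move=> i'; rewrite sumx sumxr.
  - by rewrite sum_rows beta_y_eq.
have by1' : beta_y = 1.
  by apply/eqP; rewrite eq_le by1 leNgt; apply/negP => h; apply: nlt.
(* Here beta_x < 1, so beta_y = 1 and the rows have total height 1; the paths
   are vertical. *)
have fullb : full b (rows m).
  rewrite /full sum_rows -beta_y_eq by1'; apply: eq_bigr => i' _.
  by rewrite powRr1// ltW.
have bx0 : 0 < beta_x.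
  have [i' n2] := n_ge2; have hn : \sum_(j < n i') a i' j `^ 0 = (n i')%:R.
    rewrite (eq_bigr (fun=> 1)) ?sumr_const ?card_ord// => j _.
    by rewrite powRr0.
  have [|e e0 he] := root i' 0 (lexx 0) ler01; first by rewrite hn ler1n ltnW.
  apply: lt_le_trans (beta_x_max e _); last by exists i'.
  rewrite lt_neqAle e0 andbT; apply/eqP => e0'; move: he; rewrite -e0' hn => /eqP.
  by rewrite pnatr_eq1 => /eqP n1; rewrite n1 in n2.
have n2 : (2 <= n i)%N.
  rewrite ltnNge; apply/negP => n1; have {n1}n1 : n i = 1%N.
    by apply/eqP; rewrite eqn_leq n1 n_ge1.
  pose j0 : 'I_(n i) := Ordinal (n_ge1 i).
  have : \sum_(j < n i) a i j `^ beta_x < 1.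
    rewrite (bigD1 j0)//= big1 ?addr0; last first.
      move=> j /eqP jj0; exfalso; apply: jj0; apply: val_inj => /=.
      by have := ltn_ord j; rewrite [X in (_ < X)%N]n1 ltnS leqn0 => /eqP.
    rewrite -[ltRHS](_ : 1 `^ beta_x = 1); last by rewrite powR1.
    by rewrite gt0_ltr_powR ?nnegrE// ltW.
  by rewrite hi_ ltxx.
(* A row with sum above 1 at beta_x would have an exponent beyond beta_x. *)
have sle i' : \sum_(j < n i') a i' j `^ beta_x <= 1.
  rewrite leNgt; apply/negP => gt1.
  have [e xe he] := root i' _ (ltW bx0) (ltW bx1) (ltW gt1).
  have ex : e <= beta_x by apply: beta_x_max; exists i'.
  have ee : e = beta_x by apply/eqP; rewrite eq_le ex xe.
  by rewrite -ee he ltxx in gt1.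
apply: (conformal_dim_carpet_minimal ab S_limit lo0 lohi hi1 hcols hrows
  bx0 (ltW bx0) ler01 _ c0 C0).
- by rewrite addrC.
- apply: (vertical_ladders n_ge1 ab b_lt1 S_limit lo0 lohi hi1 hcols hrows
    (ltW bx0) n2 _ fullb).
  by rewrite sumx.
- by move=> i'; rewrite sumx.
- by rewrite (eq_bigr b) ?fullb// => i' _; rewrite powRr1// ltW.
Qed.
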